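(* Let $N$ be a positive squarefree integer with $-N \not\equiv 1 \pmod 4$, let $Q(x,y)=x^2+Ny^2$, and for $n\ge 1$ let $r_{2,N}(n)=\#\{(x,y)\in\mathbb{Z}^2 : x^2+Ny^2=n\}$ (so solutions are counted with signs and order). Then, as $x\to\infty$, $$\sum_{n \le x} r_{2,N}(n)^2 \sim \frac{3}{N} \Big(\prod_{p\mid 2N} \frac{2p}{p+1} \Big)\, x\log x,$$ where the product runs over all primes $p$ dividing $2N$. *)

(* Defs.v *)
From HB Require Import structures.
From mathcomp Require Import all_boot all_order all_algebra finmap.
From mathcomp Require Import all_classical all_reals all_analysis.
From mathcomp Require Import zify.

Set Implicit Arguments.
Unset Strict Implicit.
Unset Printing Implicit Defensive.

Import Order.TTheory GRing.Theory Num.Theory.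

Local Open Scope classical_set_scope.
Local Open Scope ring_scope.

Definition squarefree (n : nat) : Prop :=
  forall d : nat, (d ^ 2 %| n)%N -> d = 1%N.

Definition form_reps (N n : nat) : set (int * int) :=
  [set xy | xy.1 ^+ 2 + N%:Z * xy.2 ^+ 2 = n%:Z].

Lemma finite_form_reps (N n : nat) : (0 < N)%N -> finite_set (form_reps N n).
Proof.
move=> N_gt0.
have [s s_sq] : exists s : seq int, forall z : int, z ^+ 2 <= n%:Z -> z \in s.
  exists ([seq k%:Z | k <- iota 0 n.+1] ++ [seq - k%:Z | k <- iota 0 n.+1]).
  move=> z zn; have {}zn : (`|z| <= n)%N by nia.
  rewrite mem_cat; apply/orP.
  case: (lerP 0 z) => z0; [left | right]; apply/mapP;
    exists `|z|%N; rewrite ?mem_iota; lia.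
apply: (@sub_finite_set _ _ [set` [seq (x, y) | x <- s, y <- s]]).
  move=> [x y]; rewrite /form_reps /= => xyn.
  by apply: allpairs_f; apply: s_sq; nia.
exact: finite_seq.
Qed.

(* [fset_set] is the empty set on infinite arguments; by [finite_form_reps]
   this default is never reached when [0 < N]. *)
Definition r2 (N n : nat) : nat := #|` fset_set (form_reps N n)|%fset.

(* Main.v *)
(* A pair of representations a^2 + N b^2 = c^2 + N d^2 = n is a solution of
   u v = N s t with u, v = a -+ c and s, t = d -+ b.  The nonzero solutions are
   u = g e x, s = g y, v = f h y, t = h x with e f = N and x, y primitive
   (gcd(x, y) = gcd(x, f) = gcd(y, e) = 1), uniquely up to a common sign, and then
     4 n = (e x^2 + f y^2) (e g^2 + f h^2).
   The parity conditions force g and h to be even or, for odd N, all four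
   variables to be odd.  Hence 2 r(n)^2 is a sum over e | N of Dirichlet
   convolutions of a primitive representation count with a representation count.
   Counting lattice points in ellipses gives the mean values of the latter.
   Removing square factors divides the logarithmic mean by a partial zeta value
   pi^2 / 6 * prod (1 - p^-2), so that the powers of pi cancel, and each
   convolution contributes a constant times x log x. *)
Require Import Defs.
From mathcomp Require Import all_boot all_order all_algebra finmap.
From mathcomp Require Import all_classical all_reals all_analysis.
From mathcomp Require Import zify ring lra.

Set Implicit Arguments.
Unset Strict Implicit.
Unset Printing Implicit Defensive.

Import Order.TTheory GRing.Theory Num.Theory.
Import numFieldNormedType.Exports.

Local Open Scope classical_set_scope.
Local Open Scope ring_scope.

(** * Counting integral representations *)

(** The partial sum of a convolution of F and G is the sum of F(k) times the partial sum of G at n /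
    k, so order x log x requires only a logarithmic mean of F and an ordinary mean of G. Logarithmic
    means are stable under dilation, because log (M^2 n) and log n differ by a constant. Square
    factors can therefore be removed from F by monotonicity, without Möbius inversion and without an
    error term for primitive points; this is why the primitive count plays the role of F.
    Squarefreeness acts through gcd(e, f) = 1. It excludes that e and f are both even in the parity
    analysis, it makes the densities of the coprimality conditions modulo f and e multiply to that
    of N, so that every e contributes the same constant, and it makes the number of divisors e a
    power of 2. Each convolution carries two ellipse areas, hence pi^2, and only the exact value of
    zeta(2) makes the constant rational; so Euler's formula is part of the proof. *)

Definition zseq (M : nat) : seq int := [seq i%:Z - M%:Z | i <- iota 0 (2 * M).+1].

Arguments zseq : simpl never.

Lemma mem_zseq M (x : int) : (x \in zseq M) = (`|x| <= M)%N.
Proof.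
apply/mapP/idP => [[i]|xM]; first by rewrite mem_iota => ? ->; lia.
by exists (absz (x + M%:Z)); rewrite ?mem_iota; lia.
Qed.

Lemma zseq_uniq M : uniq (zseq M).
Proof. by rewrite map_inj_uniq ?iota_uniq // => i j; lia. Qed.

Definition sign_weight (k : nat) : nat := if k == 0 then 1 else 2.

Lemma sum_zseq_absz M (F : nat -> nat) :
  (\sum_(x <- zseq M) F `|x|%N = \sum_(0 <= k < M.+1) sign_weight k * F k)%N.
Proof.
elim: M => [|M IH]; first by rewrite /zseq /= big_seq1 big_nat1 mul1n.
rewrite big_nat_recr //= -IH.
have /(perm_big _) -> : perm_eq (zseq M.+1) (zseq M ++ [:: M.+1%:Z; - M.+1%:Z]).
  apply: uniq_perm; first exact: zseq_uniq.
    rewrite cat_uniq zseq_uniq /= !mem_zseq; lia.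
  by move=> x; rewrite mem_cat !mem_zseq !in_cons in_nil; lia.
rewrite big_cat; congr addn.
by rewrite !big_cons big_nil abszN /sign_weight /= addn0 mul2n addnn.
Qed.

Definition zpairs (M : nat) : seq (int * int) :=
  [seq (x, y) | x <- zseq M, y <- zseq M].

Arguments zpairs : simpl never.

Lemma mem_zpairs M x y : ((x, y) \in zpairs M) = (`|x| <= M)%N && (`|y| <= M)%N.
Proof.
apply/allpairsP/idP => [[[x' y'] /= [+ + [-> ->]]]|/andP[xM yM]].
  by rewrite !mem_zseq => -> ->.
by exists (x, y); rewrite !mem_zseq.
Qed.

Lemma zpairs_uniq M : uniq (zpairs M).
Proof. by apply: allpairs_uniq; rewrite ?zseq_uniq // => -[? ?] [? ?]. Qed.

Lemma count_allpairs (S T : eqType) (s : seq S) (t : seq T) (Q : pred (S * T)) :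
  count Q [seq (x, y) | x <- s, y <- t] =
    (\sum_(x <- s) \sum_(y <- t) Q (x, y))%N.
Proof.
elim: s => [|x s IH] /=; first by rewrite big_nil.
by rewrite count_cat IH big_cons count_map -sum1_count big_mkcond.
Qed.

Definition qform (e f x y : nat) : nat := (e * x ^ 2 + f * y ^ 2)%N.

(* Each pair of natural numbers is weighted by the number of integral pairs
   with these absolute values. *)
Definition reps (e f : nat) (P : nat -> nat -> bool) (n : nat) : nat :=
  (\sum_(0 <= x < n.+1) \sum_(0 <= y < n.+1)
     sign_weight x * sign_weight y * (P x y && (qform e f x y == n)))%N.

Lemma qform_ge e f x y : (0 < e)%N -> (0 < f)%N ->
  (x <= qform e f x y)%N && (y <= qform e f x y)%N.
Proof. by rewrite /qform => e0 f0; apply/andP; split; nia. Qed.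

Lemma big_nat_widen0 (R : nmodType) m M (F : nat -> R) :
  (m <= M)%N -> (forall x, (m <= x)%N -> F x = 0) ->
  \sum_(0 <= x < M) F x = \sum_(0 <= x < m) F x.
Proof.
move=> mM F0; rewrite (@big_cat_nat _ _ _ m) //= [X in _ + X]big_nat.
by rewrite [X in _ + X]big1 ?addr0 // => x /andP[/F0].
Qed.

(** Each coordinate is bounded by the value of a form with positive coefficients, so enlarging the
    box adds nothing. A common box for all n up to M is what allows sums over n and over points to
    be exchanged. *)
Lemma reps_box e f P n M : (0 < e)%N -> (0 < f)%N -> (n <= M)%N ->
  reps e f P n = (\sum_(0 <= x < M.+1) \sum_(0 <= y < M.+1)
     sign_weight x * sign_weight y * (P x y && (qform e f x y == n)))%N.
Proof.
move=> e0 f0 nM; rewrite /reps.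
rewrite [RHS](@big_nat_widen0 nat n.+1) //; last first.
  move=> x nx; apply: big1 => y _.
  case: eqP => [E|]; rewrite ?andbF ?muln0 //.
  by have := qform_ge x y e0 f0; rewrite E; lia.
apply: eq_bigr => x _; rewrite [RHS](@big_nat_widen0 nat n.+1) // => y ny.
case: eqP => [E|]; rewrite ?andbF ?muln0 //.
by have := qform_ge x y e0 f0; rewrite E; lia.
Qed.

Lemma reps_count e f P n M : (0 < e)%N -> (0 < f)%N -> (n <= M)%N ->
  reps e f P n =
    count (fun p => P `|p.1|%N `|p.2|%N && (qform e f `|p.1| `|p.2| == n))
      (zpairs M).
Proof.
move=> e0 f0 nM; rewrite count_allpairs /= (reps_box _ e0 f0 nM).
under [RHS]eq_bigr => x _.
  rewrite (sum_zseq_absz M (fun y => P `|x|%N y && (qform e f `|x| y == n) : nat)).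
  over.
rewrite (sum_zseq_absz M (fun x => \sum_(0 <= y < M.+1) sign_weight y *
   (P x y && (qform e f x y == n)))%N).
apply: eq_bigr => x _; rewrite big_distrr /=.
by apply: eq_bigr => y _; rewrite mulnA.
Qed.

Lemma r2_count N n M : (0 < N)%N -> (n <= M)%N ->
  r2 N n = count (fun p => qform 1 N `|p.1| `|p.2| == n) (zpairs M).
Proof.
move=> N0 nM; rewrite /r2 -size_filter.
set s := [seq p <- _ | _].
have -> : form_reps N n = [set` s].
  apply/seteqP; split => -[x y] /=; rewrite /form_reps /= mem_filter /= /qform.
    by move=> E; rewrite mem_zpairs; apply/and3P; split; nia.
  by move=> /andP[/eqP]; nia.
have -> : [set` s] = [set` [fset x in s]%fset].
  by apply/seteqP; split => x /=; rewrite in_fset.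
by rewrite set_fsetK card_fseq undup_id // filter_uniq // zpairs_uniq.
Qed.

(** * Parametrization of u v = N s t *)

Lemma bezout_coprimez (a b : int) : coprimez a b -> exists c d : int, c * a + d * b = 1.
Proof. by move=> /coprimezP[[c d] /=]; exists c, d. Qed.

Lemma coprimez_split (u s : int) : (u != 0) || (s != 0) ->
  exists g r b : int, [/\ g != 0, u = g * r, s = g * b & coprimez r b].
Proof.
move=> us; have g0 : gcdz u s != 0 by rewrite gcdz_eq0; lia.
exists (gcdz u s), (u %/ gcdz u s)%Z, (s %/ gcdz u s)%Z; split => //.
- by rewrite mulrC divzK // dvdz_gcdl.
- by rewrite mulrC divzK // dvdz_gcdr.
apply/eqP/(mulfI g0); rewrite mulr1.
have {1}-> : gcdz u s = `|gcdz u s|%N by [].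
by rewrite mulz_gcdr ![gcdz u s * _]mulrC !divzK ?dvdz_gcdl ?dvdz_gcdr.
Qed.

Lemma gcd_split (r : int) (N : nat) : (0 < N)%N ->
  exists (e f : nat) (a : int), [/\ (e * f)%N = N, r = e%:Z * a & coprime `|a| f].
Proof.
move=> N0; pose e := gcdn `|r| N; have e0 : (0 < e)%N by rewrite gcdn_gt0 N0 orbT.
have /dvdnP[f fE] : (e %| N)%N by rewrite dvdn_gcdr.
have /dvdzP[a aE] : (e %| r)%Z by apply: dvdn_gcdl.
exists e, f, a; split; [by rewrite mulnC -fE|by rewrite mulrC|].
have : gcdn `|r| N = (e * gcdn `|a| f)%N.
  by rewrite muln_gcdr {1}aE {1}fE abszM /= !(mulnC e).
rewrite -/e /coprime -{1}[e]muln1 => /eqP; rewrite eqn_pmul2l // eq_sym => /eqP ->.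
by [].
Qed.

Definition cop (A B x y : nat) : bool := coprime x A && coprime y B.

Definition prim (A B x y : nat) : bool := coprime x y && cop A B x y.

(** The moduli are crossed: a has coefficient e and must be prime to f, b the reverse. Then e a / b
    is in lowest terms and gcd(e a, e f) = e, so that e can be recovered from the fraction. *)
Definition admissible (e f : nat) (a b : int) : bool := prim f e `|a| `|b|.

Lemma admissibleC e f a b : admissible e f a b = admissible f e b a.
Proof. by rewrite /admissible /prim /cop coprime_sym; congr andb; rewrite andbC. Qed.

(* In lowest terms u / s = r / b; then e := gcd(r, N), and a Bezout relation
   between a = r / e and f b produces h. *)
Lemma quad_ex_aux (N : nat) (u v s t : int) : (0 < N)%N -> u * v = N%:Z * (s * t) ->
  (u != 0) || (s != 0) ->
  exists (e f : nat) (a b g h : int), [/\ (e * f)%N = N, admissible e f a b,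
    u = g * e%:Z * a /\ s = g * b & v = f%:Z * h * b /\ t = h * a].
Proof.
move=> N0 uv us; have [g [r [b [g0 uE sE rb]]]] := coprimez_split us.
have [e [f [a [efN rE af]]]] := gcd_split r N0.
have e0 : e%:Z != 0 by lia.
have avE : a * v = f%:Z * b * t.
  apply: (mulfI e0); apply: (mulfI g0).
  by move: uv; rewrite uE sE rE -efN PoszM; lia.
have := rb; rewrite rE coprimezMl => /andP[eb ab].
have afb : coprimez a (f%:Z * b) by rewrite coprimezMr ab andbT /coprimez /gcdz /= (eqP af).
have [c [d cd]] := bezout_coprimez afb.
exists e, f, a, b, g, (c * t + d * v); split => //.
- apply/and3P; split=> //.
  by rewrite coprime_sym.
- by rewrite uE rE mulrA.
split.
  transitivity (c * (a * v) + d * (f%:Z * b) * v).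
    by rewrite -[LHS]mul1r -cd; ring.
  by rewrite avE; ring.
transitivity (c * a * t + d * (f%:Z * b * t)).
  by rewrite -[LHS]mul1r -cd; ring.
by rewrite -avE; ring.
Qed.

Lemma quad_ex (N : nat) (u v s t : int) : (0 < N)%N -> u * v = N%:Z * (s * t) ->
  [|| u != 0, s != 0, v != 0 | t != 0] ->
  exists (e f : nat) (a b g h : int), [/\ (e * f)%N = N, admissible e f a b,
    u = g * e%:Z * a /\ s = g * b & v = f%:Z * h * b /\ t = h * a].
Proof.
move=> N0 uv nz; have [us|us] := boolP ((u != 0) || (s != 0)).
  exact: quad_ex_aux uv us.
have vt : (v != 0) || (t != 0) by lia.
(* If u = s = 0, exchanging (u, s) with (v, t) and e with f reduces to the case already treated. *)
have vu : v * u = N%:Z * (t * s) by rewrite mulrC uv; ring.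
have [f [e [b [a [h [g [efN adm [vE tE] [uE sE]]]]]]]] := quad_ex_aux N0 vu vt.
exists e, f, a, b, g, h; split=> //; first by rewrite mulnC.
- by rewrite admissibleC.
- by split=> //; rewrite uE; ring.
by split=> //; rewrite vE; ring.
Qed.

Lemma coprimez_uniq (g r b g' r' b' : int) : coprimez r b -> coprimez r' b' ->
  g * r = g' * r' -> g * b = g' * b' ->
  `|g|%N = `|g'|%N.
Proof.
move=> rb rb' e1 e2; have: gcdz (g * r) (g * b) = gcdz (g' * r') (g' * b') by rewrite e1 e2.
by rewrite -!mulz_gcdr (eqP rb) (eqP rb'); lia.
Qed.

Lemma coprime_mul_admissible e f a b : admissible e f a b -> coprimez (e%:Z * a) b.
Proof.
move=> /and3P[ab _ be]; rewrite coprimezMl; apply/andP; split => //.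
by rewrite coprimez_sym.
Qed.

Lemma admissible_gcd e f a b : admissible e f a b -> gcdn `|(e%:Z * a)%R| (e * f) = e.
Proof.
by move=> /and3P[_ af _]; rewrite abszM /= -muln_gcdr (eqP af) muln1.
Qed.

(** The parameters can be read off: |g| = gcd(u, s), then e = gcd(u / g, N), and the rest follows by
    cancellation once the sign of g is chosen. Only h needs a distinction: t = h a determines it
    unless a = 0, and then v = f h b does. *)
Lemma quad_uniq_aux (N e f e' f' : nat) (a b g h a' b' g' h' : int) :
  (0 < N)%N -> (e * f)%N = N -> (e' * f')%N = N ->
  admissible e f a b -> admissible e' f' a' b' -> g != 0 ->
  g * e%:Z * a = g' * e'%:Z * a' -> g * b = g' * b' ->
  f%:Z * h * b = f'%:Z * h' * b' -> h * a = h' * a' ->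
  e = e' /\ ((a', b', g', h') = (a, b, g, h) \/ (a', b', g', h') = (- a, - b, - g, - h)).
Proof.
move=> N0 efN efN' A A' g0 E1 E2 E3 E4.
have gg : `|g|%N = `|g'|%N.
  apply: (coprimez_uniq (coprime_mul_admissible A) (coprime_mul_admissible A')) => //.
  by rewrite !mulrA.
have ee : e = e'.
  rewrite -(admissible_gcd A) -(admissible_gcd A') efN efN'; congr gcdn.
  have : (`|g| * `|(e%:Z * a)%R| = `|g'| * `|(e'%:Z * a')%R|)%N.
    by rewrite -!abszM !mulrA E1.
  rewrite -gg => /eqP; rewrite eqn_pmul2l; first by move/eqP.
  by lia.
subst e'; split=> //.
have e0 : (0 < e)%N by lia.
have f0 : (0 < f)%N by lia.
have ff : f' = f by apply/eqP; rewrite -(eqn_pmul2l e0) efN efN'.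
subst f'.
have ab0 : (a != 0) || (b != 0).
  apply/negP => /negP; rewrite negb_or !negbK => /andP[/eqP a0 /eqP b0].
  by move/and3P: A; rewrite a0 b0 => -[].
have [gE|gE] : g' = g \/ g' = - g by lia.
  left; subst g'.
  have aE : a' = a.
    have ge0 : g * e%:Z != 0 by rewrite mulf_neq0 //; lia.
    exact/esym/(mulfI ge0).
  have bE : b' = b by apply/esym/(mulfI g0).
  subst a' b'; congr (_, _).
  have [a0|a0] := eqVneq a 0; last exact/esym/(mulIf a0).
  have b0 : b != 0 by move: ab0; rewrite a0 eqxx.
  have f0' : f%:Z != 0 by lia.
  by apply/esym/(mulfI f0')/(mulIf b0).
right; subst g'.
have aE : a' = - a.
  have ge0 : g * e%:Z != 0 by rewrite mulf_neq0 //; lia.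
  by apply/esym/(mulfI ge0); rewrite mulrN E1; ring.
have bE : b' = - b by apply/esym/(mulfI g0); rewrite mulrN E2; ring.
subst a' b'; congr (_, _).
have [a0|a0] := eqVneq a 0; last by apply/(mulIf a0); rewrite mulNr E4; ring.
have b0 : b != 0 by move: ab0; rewrite a0 eqxx.
have f0' : f%:Z != 0 by lia.
by apply/(mulfI f0')/(mulIf b0); rewrite mulrN mulNr E3; ring.
Qed.

Lemma quad_uniq (N e f e' f' : nat) (a b g h a' b' g' h' : int) :
  (0 < N)%N -> (e * f)%N = N -> (e' * f')%N = N ->
  admissible e f a b -> admissible e' f' a' b' -> (g != 0) || (h != 0) ->
  g * e%:Z * a = g' * e'%:Z * a' -> g * b = g' * b' ->
  f%:Z * h * b = f'%:Z * h' * b' -> h * a = h' * a' ->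
  e = e' /\ ((a', b', g', h') = (a, b, g, h) \/ (a', b', g', h') = (- a, - b, - g, - h)).
Proof.
move=> N0 efN efN' A A' gh E1 E2 E3 E4.
have [g0|g0] := eqVneq g 0; last by apply: (quad_uniq_aux N0 efN efN' A A').
have h0 : h != 0 by move: gh; rewrite g0 eqxx.
(* For g = 0 the roles of (e, a, g) and (f, b, h) are exchanged. *)
rewrite admissibleC in A; rewrite admissibleC in A'.
have fe := efN; have fe' := efN'; rewrite mulnC in fe; rewrite mulnC in fe'.
have F3 : h * f%:Z * b = h' * f'%:Z * b' by rewrite ![_ * (_ : nat)%:Z]mulrC.
have F1 : e%:Z * g * a = e'%:Z * g' * a' by transitivity (g * e%:Z * a); [ring|rewrite E1; ring].
have [fE H] := quad_uniq_aux N0 fe fe' A A' h0 F3 E4 F1 E2.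
subst f'; split.
  have f0 : (0 < f)%N by lia.
  by apply/eqP; rewrite -(eqn_pmul2r f0) efN efN'.
by case: H => -[-> -> -> ->]; [left|right].
Qed.

Lemma coprime_odd e f : coprime e f -> odd e || odd f.
Proof.
rewrite -[odd e]negbK -[odd f]negbK -!dvdn2 -negb_and => ef.
apply/negP => /andP[e2 f2]; have : (2 %| gcdn e f)%N by rewrite dvdn_gcd e2.
by rewrite (eqP ef).
Qed.

Definition quad_parity (N : nat) (a b g h : int) : bool :=
  ((2 %| g)%Z && (2 %| h)%Z) || [&& odd N, odd `|a|, odd `|b|, odd `|g| & odd `|h|].

(** Modulo 2 the divisibilities are a linear system in g, h with determinant e a^2 + f b^2. If it is
    odd, g and h are even. If it is even, the coprimality conditions force a, b, e, f to be odd, and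
    the system only says that g and h have the same parity. *)
Lemma quad_parityE (N e f : nat) (a b g h : int) :
  (e * f)%N = N -> odd e || odd f -> admissible e f a b ->
  (2 %| g * e%:Z * a - f%:Z * h * b)%Z && (2 %| g * b - h * a)%Z =
  quad_parity N a b g h.
Proof.
move=> <- ef /and3P[ab af be].
move: ef (coprime_odd ab) (coprime_odd af) (coprime_odd be).
rewrite /quad_parity !dvdzE /= !dvdn2.
have oddB (x y : int) : odd `|(x - y)%R| = odd `|x| (+) odd `|y| by lia.
rewrite !oddB !abszM /= !oddM.
by case: (odd `|a|); case: (odd `|b|); case: (odd e); case: (odd f);
  case: (odd `|g|); case: (odd `|h|).
Qed.

(** * Pairs of representations *)

(** The pairs with [pi y = x] are counted twice: every fibre consists of y and [opp y]. In the
    application [opp] is the common sign change of the four parameters. *)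
Lemma size_double_cover (T U : eqType) (X : seq T) (Y : seq U)
    (pi : U -> T) (opp : U -> U) :
  uniq X -> uniq Y -> {in Y, forall y, pi y \in X} ->
  {in X, forall x, exists2 y, y \in Y & pi y = x} ->
  {in Y, forall y, [/\ opp y \in Y, opp y != y & pi (opp y) = pi y]} ->
  {in Y &, forall y z, pi y = pi z -> z = y \/ z = opp y} ->
  (size Y = 2 * size X)%N.
Proof.
move=> uX uY piX surj oppY inj.
transitivity (\sum_(y <- Y) \sum_(x <- X) (pi y == x))%N.
  rewrite -sum1_size big_seq [RHS]big_seq; apply: eq_bigr => y yY.
  transitivity (count_mem (pi y) X); first by rewrite count_uniq_mem // (piX y yY).
  by rewrite -sum1_count big_mkcond; apply: eq_bigr => x _; rewrite /= eq_sym; case: eqP.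
rewrite exchange_big /= -sum1_size big_distrr /= big_seq [RHS]big_seq.
apply: eq_bigr => x /surj[y yY yx]; have [oY oy opi] := oppY y yY.
transitivity (count (mem [:: y; opp y]) Y).
  rewrite -sum1_count [RHS]big_mkcond /= big_seq [RHS]big_seq; apply: eq_bigr => z zY.
  rewrite !in_cons in_nil orbF; case: eqP => [zx|zx].
    have [->|->] : z = y \/ z = opp y by apply: inj => //; rewrite yx zx.
      by rewrite eqxx.
    by rewrite eqxx orbT.
  case: eqP => [zy|_]; first by move: zx; rewrite zy yx.
  by case: eqP => [zy|_] //; move: zx; rewrite zy opi yx.
rewrite -size_filter.
have /perm_size -> // : perm_eq [seq z <- Y | z \in [:: y; opp y]] [:: y; opp y].
apply: uniq_perm; first exact: filter_uniq.
  by rewrite /= andbT in_cons in_nil orbF eq_sym.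
move=> z; rewrite mem_filter !in_cons in_nil orbF.
by apply/andP/idP => [[]//|]; case/orP => /eqP ->; rewrite eqxx ?orbT.
Qed.

Definition zquads (M : nat) : seq ((int * int) * (int * int)) :=
  [seq (p, q) | p <- zpairs M, q <- zpairs M].

Lemma mem_zquads M a b c d : ((a, b, (c, d)) \in zquads M) =
  [&& `|a| <= M, `|b| <= M, `|c| <= M & `|d| <= M]%N.
Proof.
rewrite andbA -!mem_zpairs.
apply/allpairsP/andP => [[[p q] /= [pM qM [-> ->]]]|[pM qM]] //.
by exists ((a, b), (c, d)).
Qed.

Lemma zquads_uniq M : uniq (zquads M).
Proof. by apply: allpairs_uniq; rewrite ?zpairs_uniq // => -[? ?] [? ?]. Qed.

Lemma qformZ e f (a b : int) :
  (qform e f `|a| `|b|)%:Z = e%:Z * a ^+ 2 + f%:Z * b ^+ 2.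
Proof. by rewrite /qform; lia. Qed.

Lemma qform_mulZ e f (a b g h : int) :
  ((qform e f `|a| `|b| * qform e f `|g| `|h|)%N)%:Z =
  (e%:Z * a ^+ 2 + f%:Z * b ^+ 2) * (e%:Z * g ^+ 2 + f%:Z * h ^+ 2).
Proof. by rewrite PoszM !qformZ. Qed.

Definition quad_valid (N n : nat) (y : nat * ((int * int) * (int * int))) : bool :=
  let: (e, ((a, b), (g, h))) := y in
  let f := (N %/ e)%N in
  [&& admissible e f a b, quad_parity N a b g h &
      (qform e f `|a| `|b| * qform e f `|g| `|h| == 4 * n)%N].

Definition quads (N n : nat) : seq (nat * ((int * int) * (int * int))) :=
  [seq y <- [seq (e, pq) | e <- divisors N, pq <- zquads (4 * n)] | quad_valid N n y].

Definition rep_pairs (N n : nat) : seq ((int * int) * (int * int)) :=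
  [seq x <- zquads n | (qform 1 N `|x.1.1| `|x.1.2| == n) &&
                       (qform 1 N `|x.2.1| `|x.2.2| == n)].

Lemma size_rep_pairs N n : (0 < N)%N -> size (rep_pairs N n) = (r2 N n ^ 2)%N.
Proof.
move=> N0; rewrite size_filter count_allpairs /= (r2_count N0 (leqnn n)).
rewrite -mulnn -sum1_count big_distrl /= [RHS]big_mkcond; apply: eq_bigr => p _.
case: (qform 1 N `|p.1| `|p.2| == n) => /=; last by rewrite big1.
by rewrite mul1n [RHS]big_mkcond.
Qed.

(** Inverts u = A - C, v = A + C, s = D - B, t = D + B for the representations (A, B) and (C, D).
    The divisions by 2 are exact on [quads] by the parity condition. *)
Definition quad_map (N : nat) (y : nat * ((int * int) * (int * int))) :
    (int * int) * (int * int) :=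
  let: (e, ((a, b), (g, h))) := y in
  let f := (N %/ e)%N in
  let u := g * e%:Z * a in let v := f%:Z * h * b in
  let s := g * b in let t := h * a in
  ((((u + v) %/ 2)%Z, ((t - s) %/ 2)%Z), (((v - u) %/ 2)%Z, ((t + s) %/ 2)%Z)).

Lemma even_diff (u v : int) : (2 %| u - v)%Z ->
  exists A C : int, [/\ u = A - C, v = A + C, ((u + v) %/ 2)%Z = A & ((v - u) %/ 2)%Z = C].
Proof.
move=> /dvdzP[k kE]; exists (v + k), (- k); split; first by lia.
- by lia.
- have -> : u + v = (v + k) * 2 by lia.
  by rewrite mulzK.
have -> : v - u = - k * 2 by lia.
by rewrite mulzK.
Qed.

Lemma mem_divisors_mul N e : (0 < N)%N -> (e \in divisors N) = (e * (N %/ e) == N)%N.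
Proof. by move=> N0; rewrite -dvdn_divisors // mulnC dvdn_eq. Qed.

(** For n > 0 the two factors of 4 n are positive, so each is at most 4 n and bounds its own
    variables; the box in [quads] is no restriction. *)
Lemma mem_quads N n e a b g h : (0 < N)%N -> (0 < n)%N ->
  ((e, ((a, b), (g, h))) \in quads N n) =
  (e * (N %/ e) == N)%N && quad_valid N n (e, ((a, b), (g, h))).
Proof.
move=> N0 n0; rewrite mem_filter andbC -mem_divisors_mul //.
have [V|] := boolP (quad_valid N n _); last by rewrite !andbF.
rewrite !andbT; apply/allpairsP/idP => [[[e' pq] /= [e'N _ [-> _]]]|eN] //.
exists (e, ((a, b), (g, h))); split => //=.
move: eN V; rewrite mem_divisors_mul // => /eqP eN /and3P[_ _ /eqP V].
have e0 : (0 < e)%N by lia.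
have f0 : (0 < N %/ e)%N by lia.
rewrite mem_zquads.
have /andP[] := qform_ge `|a| `|b| e0 f0; have /andP[] := qform_ge `|g| `|h| e0 f0.
move: V; set q1 := qform _ _ _ _; set q2 := qform _ _ _ _ => V.
have q1M : (q1 <= 4 * n)%N by rewrite -V leq_pmulr //; lia.
have q2M : (q2 <= 4 * n)%N by rewrite -V leq_pmull //; lia.
by move=> H1 H2 H3 H4; apply/and4P; split; lia.
Qed.

(** The first equation says that the form takes equal values at (A, B) and (C, D), the second that
    these values add up to 2 n. *)
Lemma quad_norms (N n : nat) (A B C D : int) :
  (A - C) * (A + C) = N%:Z * ((D - B) * (D + B)) ->
  (A - C) ^+ 2 + (A + C) ^+ 2 + N%:Z * ((D - B) ^+ 2 + (D + B) ^+ 2) = (4 * n)%N ->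
  (qform 1 N `|A| `|B|)%:Z = n%:Z /\ (qform 1 N `|C| `|D|)%:Z = n%:Z.
Proof. by move=> uv nrm; rewrite !qformZ !mul1r; split; lia. Qed.

Lemma size_quads N n : (0 < N)%N -> (forall e f, (e * f)%N = N -> odd e || odd f) ->
  (0 < n)%N -> size (quads N n) = (2 * r2 N n ^ 2)%N.
Proof.
move=> N0 Nodd n0; rewrite -size_rep_pairs //.
apply: (@size_double_cover _ _ _ _ (quad_map N)
  (fun y => (y.1, ((- y.2.1.1, - y.2.1.2), (- y.2.2.1, - y.2.2.2))))).
- by rewrite filter_uniq // zquads_uniq.
- rewrite filter_uniq // allpairs_uniq //; [exact: divisors_uniq|exact: zquads_uniq|].
  by move=> [? ?] [? ?].
- move=> [e [[a b] [g h]]]; rewrite mem_quads // => /andP[/eqP efN /and3P[adm par /eqP E]].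
  move: par; rewrite -(quad_parityE _ _ efN (Nodd _ _ efN) adm) => /andP[/even_diff[A [C [uE vE AE CE]]]].
  move=> /even_diff[D [B [sE tE DE BE]]].
  rewrite mem_filter /quad_map AE CE [h * a + g * b]addrC DE BE.
  set f := (N %/ e)%N in efN adm E uE vE.
  have uv : (g * e%:Z * a) * (f%:Z * h * b) = N%:Z * ((g * b) * (h * a)).
    by rewrite -efN PoszM; ring.
  (* The product (e a^2 + f b^2) (e g^2 + f h^2) expands to u^2 + v^2 + N (s^2 + t^2), which is
     twice the sum of the two values of the form; hence the 4 in 4 n. *)
  have nrm : (g * e%:Z * a) ^+ 2 + (f%:Z * h * b) ^+ 2
      + N%:Z * ((g * b) ^+ 2 + (h * a) ^+ 2) = (4 * n)%N.
    by rewrite -E qform_mulZ -efN PoszM; ring.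
  rewrite uE vE sE tE in uv nrm.
  have [[E1] [E2]] := quad_norms uv nrm; rewrite /= E1 E2 eqxx /= mem_zquads.
  have := qform_ge `|A| `|B| (isT : (0 < 1)%N) N0.
  have := qform_ge `|C| `|D| (isT : (0 < 1)%N) N0.
  by rewrite E1 E2 => /andP[-> ->] /andP[-> ->].
- move=> [[A B] [C D]]; rewrite mem_filter /= => /andP[/andP[/eqP E1 /eqP E2] _].
  have F1 : A ^+ 2 + N%:Z * B ^+ 2 = n by rewrite -E1 qformZ mul1r.
  have F2 : C ^+ 2 + N%:Z * D ^+ 2 = n by rewrite -E2 qformZ mul1r.
  have uv : (A - C) * (A + C) = N%:Z * ((D - B) * (D + B)).
    by move: F1 F2; clear; lia.
  have nz : [|| A - C != 0, D - B != 0, A + C != 0 | D + B != 0].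
    apply/negP => /negP; rewrite !negb_or !negbK => /and4P[/eqP h1 /eqP h2 /eqP h3 /eqP h4].
    have A0 : A = 0 by move: h1 h3; clear; lia.
    have B0 : B = 0 by move: h2 h4; clear; lia.
    by move: F1 n0; rewrite A0 B0; clear; lia.
  have [e [f [a [b [g [h [efN adm [uE sE] [vE tE]]]]]]]] := quad_ex N0 uv nz.
  have fE : (N %/ e)%N = f by rewrite -efN mulKn //; move: N0 efN; clear; lia.
  exists (e, ((a, b), (g, h))).
    rewrite mem_quads // fE efN eqxx /= fE adm /=.
    rewrite -(quad_parityE _ _ efN (Nodd _ _ efN) adm) -uE -vE -sE -tE.
    apply/andP; split.
    + by apply/andP; split; apply/dvdzP; [exists (- C)|exists (- B)]; ring.
    rewrite -eqz_nat qform_mulZ; apply/eqP.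
    have -> : (e%:Z * a ^+ 2 + f%:Z * b ^+ 2) * (e%:Z * g ^+ 2 + f%:Z * h ^+ 2) =
      (g * e%:Z * a) ^+ 2 + (f%:Z * h * b) ^+ 2
      + (e * f)%N%:Z * ((g * b) ^+ 2 + (h * a) ^+ 2) by rewrite PoszM; ring.
    by move: F1 F2; rewrite efN -uE -vE -sE -tE; clear; lia.
  rewrite /quad_map fE -uE -vE -sE -tE.
  have H (x y : int) : x = y * 2 -> (x %/ 2)%Z = y by move=> ->; rewrite mulzK.
  by congr (_, _, (_, _)); apply: H; ring.
- move=> [e [[a b] [g h]]]; rewrite !mem_quads // => /andP[efN V].
  rewrite efN /=; split.
  + by move: V; rewrite /= /admissible /quad_parity !dvdzE !abszN.
  + apply/negP => /eqP[ha hb _ _].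
    have a0 : a = 0 by move: ha; clear; lia.
    have b0 : b = 0 by move: hb; clear; lia.
    by move/and3P: V => [+ _ _]; rewrite a0 b0 /admissible /prim.
  by rewrite /quad_map /=; congr (_, _, (_, _)); congr divz; ring.
move=> [e [[a b] [g h]]] [e' [[a' b'] [g' h']]].
rewrite !mem_quads // => /andP[/eqP efN /and3P[adm par /eqP E]].
move=> /andP[/eqP efN' /and3P[adm' par' /eqP E']].
move: par par'; rewrite -(quad_parityE _ _ efN (Nodd _ _ efN) adm).
rewrite -(quad_parityE _ _ efN' (Nodd _ _ efN') adm').
move=> /andP[/even_diff[A [C [uE vE AE CE]]]].
move=> /even_diff[D [B [sE tE DE BE]]].
move=> /andP[/even_diff[A' [C' [uE' vE' AE' CE']]]].
move=> /even_diff[D' [B' [sE' tE' DE' BE']]].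
rewrite /quad_map AE CE AE' CE' [h * a + g * b]addrC [h' * a' + g' * b']addrC DE BE DE' BE'.
move=> [AA BB CC DD].
have gh : (g != 0) || (h != 0).
  apply/negP => /negP; rewrite negb_or !negbK => /andP[/eqP g0 /eqP h0].
  by move: E n0; rewrite g0 h0 /qform /=; clear; lia.
have E1 : g * e%:Z * a = g' * e'%:Z * a' by rewrite uE uE' AA CC.
have E2 : g * b = g' * b' by rewrite sE sE' BB DD.
have E3 : (N %/ e)%N%:Z * h * b = (N %/ e')%N%:Z * h' * b' by rewrite vE vE' AA CC.
have E4 : h * a = h' * a' by rewrite tE tE' BB DD.
have [-> [[-> -> -> ->]|[-> -> -> ->]]] := quad_uniq N0 efN efN' adm adm' gh E1 E2 E3 E4.
  by left.
by right.
Qed.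

(** * The convolution identity *)

(** A double sum over a box, rather than a sum over divisors, so that summations can be exchanged
    directly. *)
Definition dconv (f g : nat -> nat) (m : nat) : nat :=
  (\sum_(1 <= k < m.+1) \sum_(1 <= l < m.+1) (k * l == m) * (f k * g l))%N.

Lemma sum_nat_eq (F : nat -> nat) a m n : (m <= a < n)%N ->
  (\sum_(m <= k < n) (a == k) * F k = F a)%N.
Proof.
move=> amn; rewrite (bigD1_seq a) /= ?mem_index_iota ?iota_uniq // eqxx mul1n.
by rewrite big1 ?addn0 // => k ka; rewrite eq_sym (negbTE ka).
Qed.

Lemma mul_bounds x y m : (x * y = m -> 0 < m -> 1 <= x < m.+1)%N.
Proof. by move=> <-; rewrite muln_gt0 => /andP[x0 y0]; rewrite x0 ltnS leq_pmulr. Qed.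

Lemma count_dconv e f (P Q : nat -> nat -> bool) m M :
  (0 < e)%N -> (0 < f)%N -> (0 < m)%N -> (m <= M)%N ->
  (\sum_(p <- zpairs M) \sum_(q <- zpairs M)
     [&& P `|p.1| `|p.2|, Q `|q.1| `|q.2| &
         qform e f `|p.1| `|p.2| * qform e f `|q.1| `|q.2| == m] =
   dconv (reps e f P) (reps e f Q) m)%N.
Proof.
move=> e0 f0 m0 mM; rewrite /dconv.
pose q (p : int * int) := qform e f `|p.1| `|p.2|.
have repsE R k : (k <= m)%N ->
    reps e f R k = (\sum_(p <- zpairs M) (R `|p.1|%N `|p.2|%N && (q p == k)))%N.
  move=> km; rewrite (@reps_count _ _ _ _ M) //; last exact: leq_trans mM.
  by rewrite -sum1_count big_mkcond.
transitivity (\sum_(1 <= k < m.+1) \sum_(1 <= l < m.+1)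
    \sum_(p <- zpairs M) \sum_(p' <- zpairs M)
    (k * l == m) * ((P `|p.1|%N `|p.2|%N && (q p == k)) *
                    (Q `|p'.1|%N `|p'.2|%N && (q p' == l))))%N; last first.
  rewrite big_nat_cond [RHS]big_nat_cond; apply: eq_bigr => k /andP[/andP[_ km] _].
  rewrite big_nat_cond [RHS]big_nat_cond; apply: eq_bigr => l /andP[/andP[_ lm] _].
  rewrite !repsE // big_distrl big_distrr /=; apply: eq_bigr => p _.
  by rewrite big_distrr big_distrr.
under [RHS]eq_bigr => k _ do rewrite exchange_big.
rewrite [RHS]exchange_big; apply: eq_bigr => p _ /=.
under [RHS]eq_bigr => k _ do rewrite exchange_big.
rewrite [RHS]exchange_big; apply: eq_bigr => p' _ /=.
rewrite -/(q p) -/(q p').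
case: (P `|p.1|%N `|p.2|%N) => /=; last first.
  by rewrite big1 // => k _; rewrite big1 // => l _; rewrite muln0.
case: (Q `|p'.1|%N `|p'.2|%N) => /=; last first.
  by rewrite big1 // => k _; rewrite big1 // => l _; rewrite !muln0.
have [E|E] := eqVneq (q p * q p')%N m; last first.
  rewrite big1 // => k _; rewrite big1 // => l _.
  case: (eqVneq (q p) k) => [<-|]; last by rewrite muln0.
  case: (eqVneq (q p') l) => [<-|]; last by rewrite !muln0.
  by rewrite (negbTE E).
have qp : (1 <= q p < m.+1)%N by apply: mul_bounds E m0.
have qp' : (1 <= q p' < m.+1)%N by apply: (@mul_bounds _ (q p)); rewrite // mulnC.
under eq_bigr => k _.
  have -> : (\sum_(1 <= l < m.+1) (k * l == m) * ((q p == k) * (q p' == l)) =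
     \sum_(1 <= l < m.+1) (q p' == l) * ((q p == k) * (k * l == m)))%N.
    by apply: eq_bigr => l _; lia.
  rewrite (@sum_nat_eq (fun l => (q p == k) * (k * l == m))%N) //.
  over.
by rewrite (@sum_nat_eq (fun k => (k * q p' == m)%N : nat)) //= E eqxx.
Qed.

(** Halving both coordinates divides the form by 4. Here c is the value of the form at (a, b), and
    the case of even g and h loses its factor 4. *)
Lemma count_double e f c m M : (0 < e)%N -> (0 < f)%N -> (0 < c)%N -> (0 < m)%N ->
  (4 * m <= M)%N ->
  (\sum_(q <- zpairs M) [&& (2 %| q.1)%Z, (2 %| q.2)%Z &
      c * qform e f `|q.1| `|q.2| == 4 * m] =
   \sum_(q <- zpairs M) (c * qform e f `|q.1| `|q.2| == m))%N.
Proof.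
move=> e0 f0 c0 m0 mM.
move: (zpairs M) (mem_zpairs M) (zpairs_uniq M) => s memM uM.
have sumE (P : pred (int * int)) :
    (\sum_(q <- s) P q)%N = size [seq q <- s | P q].
  by rewrite size_filter -sum1_count [RHS]big_mkcond.
rewrite (sumE (fun q => [&& (2 %| q.1)%Z, (2 %| q.2)%Z &
      c * qform e f `|q.1| `|q.2| == 4 * m]%N)).
rewrite (sumE (fun q => c * qform e f `|q.1| `|q.2| == m)%N).
rewrite -[RHS](size_map (fun q : int * int => (q.1 * 2, q.2 * 2))).
have dbl (x y : int) : qform e f `|(x * 2)%R| `|(y * 2)%R| = (4 * qform e f `|x| `|y|)%N.
  by rewrite /qform !abszM /= !expnMn; lia.
apply: perm_size; apply: uniq_perm.
- by rewrite filter_uniq //.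
- rewrite map_inj_uniq ?filter_uniq // => -[x y] [x' y'] /= [? ?].
  by congr pair; lia.
move=> [x y]; apply/idP/mapP => [|[[x' y']]].
  rewrite mem_filter memM => /andP[/= /and3P[/dvdzP[x' xE] /dvdzP[y' yE] /eqP E] _].
  exists (x', y'); last by rewrite xE yE.
  rewrite mem_filter memM /=.
  move: E; rewrite xE yE dbl => E.
  have {}E : (c * qform e f `|x'| `|y'|)%N = m by lia.
  rewrite E eqxx /=; have /andP[] := qform_ge `|x'| `|y'| e0 f0.
  by move: E; set q := qform _ _ _ _ => E H1 H2; apply/andP; split; nia.
rewrite mem_filter memM => /andP[/= /eqP E _] [-> ->].
rewrite mem_filter memM /= !dvdz_mull //= dbl mulnCA E eqxx /=.
have /andP[] := qform_ge `|(x' * 2)%R| `|(y' * 2)%R| e0 f0.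
by rewrite dbl; move: E; set q := qform _ _ _ _ => E H1 H2; apply/andP; split; nia.
Qed.

Lemma qform_gt0_prim e f A B x y : (0 < e)%N -> (0 < f)%N -> prim A B x y ->
  (0 < qform e f x y)%N.
Proof.
move=> e0 f0 /andP[xy _]; rewrite lt0n; apply/negP => /eqP q0.
have /andP[] := qform_ge x y e0 f0; rewrite q0 !leqn0 => /eqP x0 /eqP y0.
by move: xy; rewrite x0 y0.
Qed.

(** Oddness is coprimality to 2. Thus the odd case has the same shape as the even one, with doubled
    moduli, and the same mean value results cover both. *)
Lemma prim_double A B x y : odd x && odd y && prim A B x y = prim (2 * A) (2 * B) x y.
Proof.
rewrite /prim /cop !coprimeMr !coprimen2.
by case: (odd x); case: (odd y); rewrite //= ?andbF.
Qed.

(** The two alternatives of [quad_parity] exclude each other through the parity of g, so their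
    indicators add up to one convolution each. The odd one cannot be halved and keeps the argument 4
    n. *)
Lemma r2_sqr_dconv N n : (0 < N)%N -> (forall e f, (e * f)%N = N -> odd e || odd f) ->
  (0 < n)%N ->
  (2 * r2 N n ^ 2 = \sum_(e <- divisors N)
    (dconv (reps e (N %/ e) (prim (N %/ e) e)) (reps e (N %/ e) (cop 1 1)) n +
     odd N * dconv (reps e (N %/ e) (prim (2 * (N %/ e)) (2 * e)))
                   (reps e (N %/ e) (cop 2 2)) (4 * n)))%N.
Proof.
move=> N0 Nodd n0; rewrite -size_quads // size_filter count_allpairs.
rewrite big_seq [RHS]big_seq; apply: eq_bigr => e.
rewrite mem_divisors_mul // => /eqP; set f := (N %/ e)%N => efN.
have e0 : (0 < e)%N by lia.
have f0 : (0 < f)%N by lia.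
have sumE (F : pred ((int * int) * (int * int))) M : (\sum_(x <- zquads M) F x =
   \sum_(p <- zpairs M) \sum_(q <- zpairs M) F (p, q))%N.
  by rewrite -count_allpairs -sum1_count [RHS]big_mkcond.
rewrite (sumE (fun pq => quad_valid N n (e, pq))).
rewrite -(@count_dconv e f _ _ n (4 * n)) //; last by lia.
rewrite -(@count_dconv e f _ _ (4 * n) (4 * n)) //; last by lia.
rewrite big_distrr -big_split /=; apply: eq_bigr => -[a b] _.
rewrite -/f /= /admissible.
have [P|nP] := boolP (prim f e `|a| `|b|); last first.
  rewrite big1; last by move=> [g h] _.
  rewrite big1; last by move=> [g h] _.
  rewrite big1 ?muln0 // => -[g h] _ /=; rewrite -prim_double (negbTE nP) !andbF //.
under [X in _ = (X + _)%N]eq_bigr => q _ do rewrite /cop !coprimen1 /=.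
rewrite -count_double ?(qform_gt0_prim e0 f0 P) // big_distrr -big_split /=.
apply: eq_bigr => -[g h] _ /=.
rewrite -prim_double P !andbT /quad_parity /cop !coprimen2 /=.
rewrite !dvdzE /= !dvdn2.
case: (_ == (4 * n)%N); rewrite ?andbF ?muln0 ?addn0 ?andbT //.
by case: (odd N); case: (odd `|a|); case: (odd `|b|); case: (odd `|g|); case: (odd `|h|).
Qed.

(** * Partial sums and error terms *)

Definition psum {R : realType} (f : nat -> R) (n : nat) : R :=
  \sum_(1 <= k < n.+1) f k.

(** Harmonic numbers replace the logarithm until the final passage to real x: they are the
    logarithmic sum of the constant 1 without any error term. *)
Definition harm {R : realType} : nat -> R := psum (fun k => k%:R^-1).

Lemma psum0 {R : realType} (f : nat -> R) : psum f 0 = 0.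
Proof. by rewrite /psum big_geq. Qed.

Lemma psumS {R : realType} (f : nat -> R) n : psum f n.+1 = psum f n + f n.+1.
Proof. by rewrite /psum big_nat_recr. Qed.

Lemma psumD {R : realType} (f g : nat -> R) n :
  psum (fun k => f k + g k) n = psum f n + psum g n.
Proof. exact: big_split. Qed.

Lemma psumZ {R : realType} (c : R) (f : nat -> R) n :
  psum (fun k => c * f k) n = c * psum f n.
Proof. by rewrite /psum big_distrr. Qed.

Lemma ler_psum {R : realType} (f g : nat -> R) n :
  (forall k, (0 < k <= n)%N -> f k <= g k) -> psum f n <= psum g n.
Proof. by move=> fg; apply: ler_sum_nat => k kn; apply: fg. Qed.

Lemma eq_psum {R : realType} (f g : nat -> R) n :
  (forall k, (0 < k <= n)%N -> f k = g k) -> psum f n = psum g n.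
Proof. by move=> fg; apply: eq_big_nat => k kn; apply: fg. Qed.

Lemma psum_const {R : realType} (c : R) n : psum (fun=> c) n = c * n%:R.
Proof. by rewrite /psum sumr_const_nat subn1 mulr_natr. Qed.

Lemma psum_ge0 {R : realType} (f : nat -> R) n :
  (forall k, 0 <= f k) -> 0 <= psum f n.
Proof. by move=> f0; apply: sumr_ge0. Qed.

Lemma ler_norm_psum {R : realType} (f g : nat -> R) n :
  (forall k, (0 < k <= n)%N -> `|f k| <= g k) -> `|psum f n| <= psum g n.
Proof. by move=> fg; apply: le_trans (ler_norm_sum _ _ _) _; apply: ler_psum. Qed.

Lemma psum_mono {R : realType} (f : nat -> R) m n :
  (forall k, 0 <= f k) -> (m <= n)%N -> psum f m <= psum f n.
Proof.
move=> f0 mn; rewrite /psum (@big_cat_nat _ _ _ m.+1 1 n.+1) //= lerDl.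
exact: sumr_ge0.
Qed.

Lemma harm_ge0 {R : realType} n : 0 <= harm n :> R.
Proof. by apply: psum_ge0 => k; rewrite invr_ge0. Qed.

Lemma abel_psum {R : realType} (f : nat -> R) n :
  psum (fun k => f k / k%:R) n =
  psum (fun k => psum f k / (k%:R * k.+1%:R)) n + psum f n / n.+1%:R.
Proof.
elim: n => [|n IH]; first by rewrite !psum0 mul0r addr0.
rewrite psumS IH [in RHS]psumS psumS -!natr1.
have n0 : 0 <= n%:R :> R by [].
by field; do ?split; lra.
Qed.

(** All weights in Abel summation are nonnegative, so a bound between partial sums survives the
    division by k. *)
Lemma abel_bound {R : realType} (f g : nat -> R) n :
  (forall k, `|psum f k| <= psum g k) ->
  `|psum (fun k => f k / k%:R) n| <= psum (fun k => g k / k%:R) n.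
Proof.
move=> fg; rewrite !abel_psum.
apply: le_trans (ler_normD _ _) _; apply: lerD.
  apply: ler_norm_psum => k _; rewrite normrM [X in _ * X]ger0_norm ?invr_ge0 ?mulr_ge0 //.
  by rewrite ler_wpM2r ?invr_ge0 ?mulr_ge0.
by rewrite normrM [X in _ * X]ger0_norm ?invr_ge0 // ler_wpM2r ?invr_ge0.
Qed.

(* For g tending to infinity this says E = o(g), without a threshold on n. *)
Definition negl {R : realType} (E g : nat -> R) : Prop :=
  forall eps : R, 0 < eps -> exists C : R, forall n, `|E n| <= eps * g n + C.

Lemma negl_eq {R : realType} (E E' g : nat -> R) : E =1 E' -> negl E g -> negl E' g.
Proof. by move=> EE H eps /H[C HC]; exists C => n; rewrite -EE. Qed.

Lemma neglD {R : realType} (E E' g : nat -> R) :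
  negl E g -> negl E' g -> negl (fun n => E n + E' n) g.
Proof.
move=> H H' eps e0; have e2 : 0 < eps / 2 by lra.
have [C HC] := H _ e2; have [C' HC'] := H' _ e2; exists (C + C') => n.
by apply: le_trans (ler_normD _ _) _; have := HC n; have := HC' n; lra.
Qed.

Lemma neglZ {R : realType} (c : R) (E g : nat -> R) :
  negl E g -> negl (fun n => c * E n) g.
Proof.
move=> H eps e0; have c0 : 0 < `|c| + 1 by have := normr_ge0 c; lra.
have [C HC] := H _ (divr_gt0 e0 c0); exists ((`|c| + 1) * C) => n.
rewrite normrM; apply: (@le_trans _ _ ((`|c| + 1) * `|E n|)).
  by rewrite ler_wpM2r //; lra.
apply: le_trans (_ : (`|c| + 1) * (eps / (`|c| + 1) * g n + C) <= _).
  by rewrite ler_wpM2l // ltW.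
rewrite mulrDr mulrA [(`|c| + 1) * (eps / _)]mulrC divfK //; exact: lt0r_neq0.
Qed.

Lemma negl_sum {R : realType} (I : eqType) (s : seq I) (E : I -> nat -> R) g :
  (forall n, 0 <= g n) -> {in s, forall i, negl (E i) g} ->
  negl (fun n => \sum_(i <- s) E i n) g.
Proof.
move=> g0; elim: s => [_|i s IH H].
  by move=> eps e0; exists 0 => n; rewrite big_nil normr0 addr0 mulr_ge0 // ltW.
have Hs : {in s, forall j, negl (E j) g} by move=> j js; apply: H; rewrite in_cons js orbT.
have Hi : negl (E i) g by apply: H; rewrite in_cons eqxx.
by apply: negl_eq (neglD Hi (IH Hs)) => n; rewrite big_cons.
Qed.

Definition mean_value {R : realType} (f : nat -> R) (c : R) : Prop :=
  negl (fun n => psum f n - c * n%:R) (fun n => n%:R).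

Definition log_mean {R : realType} (f : nat -> R) (c : R) : Prop :=
  negl (fun n => psum (fun k => f k / k%:R) n - c * harm n) harm.

Lemma mean_value_log_mean {R : realType} (f : nat -> R) c :
  mean_value f c -> log_mean f c.
Proof.
move=> H eps /H[C HC]; exists C => n.
have C0 : 0 <= C by have := HC 0%N; rewrite psum0 mulr0 subrr normr0 mulr0 add0r.
(* A majorant with partial sums eps k + C. Placing all of C at k = 1 makes it contribute C to the
   logarithmic sum, and not C times [harm n]. *)
pose g k : R := eps + C * (k == 1%N)%:R.
have sumg k : (0 < k)%N -> psum g k = eps * k%:R + C.
  elim: k => // k IH _; rewrite psumS; have [->|k0] := posnP k.
    by rewrite psum0 /g eqxx !mulr1 add0r.
  rewrite IH // /g; case: k k0 {IH} => // k _; rewrite eqSS /= mulr0 addr0 -[in RHS]natr1.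
  by ring.
have := @abel_bound R (fun k => f k - c) g n.
have -> : psum (fun k => (f k - c) / k%:R) n =
    psum (fun k => f k / k%:R) n - c * harm n.
  rewrite -psumZ -[X in _ = _ - X]mul1r -mulNr -psumZ -psumD; apply: eq_psum => k _.
  by rewrite mulrBl mulN1r.
move=> B; apply: le_trans (B _) _.
  move=> k; have -> : psum (fun k => f k - c) k = psum f k - c * k%:R.
    by rewrite psumD psum_const mulNr.
  have [->|k0] := posnP k; first by rewrite !psum0 mulr0 subrr normr0.
  by rewrite sumg.
have -> : psum (fun k => g k / k%:R) n =
    eps * harm n + C * psum (fun k => (k == 1%N)%:R) n.
  rewrite -!psumZ -psumD; apply: eq_psum => k _; rewrite /g mulrDl; congr (_ + _).
  by case: eqP => [->|_]; rewrite ?mulr0 ?mul0r // invr1 mulr1.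
rewrite lerD2l; case: n {B} => [|n]; first by rewrite psum0 mulr0.
have -> : psum (fun k => (k == 1%N)%:R) n.+1 = 1 :> R.
  elim: n => [|n IH]; first by rewrite psumS psum0 add0r eqxx.
  by rewrite psumS IH eqSS addr0.
by rewrite mulr1.
Qed.

(** There are M n terms beyond the n-th, each at most 1 / n. *)
Lemma harm_mul {R : realType} M n : harm (M.+1 * n) <= harm n + M%:R :> R.
Proof.
have [->|n0] := posnP n; first by rewrite muln0 /harm !psum0 add0r.
rewrite /harm /psum (@big_cat_nat _ _ _ n.+1 1) //=; last by rewrite ltnS leq_pmull.
rewrite lerD2l; apply: (@le_trans _ _ (\sum_(n.+1 <= k < (M.+1 * n).+1) n%:R^-1)).
  apply: ler_sum_nat => k /andP[nk _]; rewrite lef_pV2 ?posrE ?ltr0n //; last by lia.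
  by rewrite ler_nat ltnW.
rewrite sumr_const_nat subSS mulSn addKn -[X in X <= _]mulr_natr natrM mulrCA mulVf ?mulr1 //.
by rewrite pnatr_eq0 -lt0n.
Qed.

Lemma harm_ge_ln {R : realType} n : ln n.+1%:R <= harm n :> R.
Proof.
elim: n => [|n IH]; first by rewrite ln1 /harm psum0.
rewrite /harm psumS -/harm; have n0 : 0 < n.+1%:R :> R by rewrite ltr0n.
have -> : n.+2%:R = n.+1%:R * (1 + n.+1%:R^-1) :> R.
  by rewrite mulrDr mulr1 divff ?gt_eqF // natr1.
have i0 : 0 < n.+1%:R^-1 :> R by rewrite invr_gt0.
rewrite lnM ?posrE ?addr_gt0 //.
by apply: lerD => //; apply: le_ln1Dx; apply: lt_trans i0; rewrite oppr_lt0.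
Qed.

Lemma harm_le_ln {R : realType} n : harm n.+1 <= 1 + ln n.+1%:R :> R.
Proof.
elim: n => [|n IH]; first by rewrite /harm psumS psum0 add0r invr1 ln1 addr0.
rewrite /harm psumS -/harm.
have n0 : 0 < n.+1%:R :> R by rewrite ltr0n.
have n1 : 0 < n.+2%:R :> R by rewrite ltr0n.
suff H : n.+2%:R^-1 <= ln n.+2%:R - ln n.+1%:R :> R.
  by apply: le_trans (lerD IH H) _; rewrite -addrA subrKC.
rewrite -ln_div ?posrE // -[X in X <= _]opprK -[X in _ <= X]opprK lerN2 -lnV ?posrE ?divr_gt0 //.
have -> : (n.+2%:R / n.+1%:R)^-1 = 1 - n.+2%:R^-1 :> R.
  rewrite invf_div -{1}[n.+1%:R](addrK 1) natr1 mulrBl divff ?gt_eqF // mul1r //.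
apply: le_ln1Dx; rewrite ltrN2 invf_lt1 // ltr1n //.
Qed.

Lemma harm_unbounded {R : realType} (A : R) : exists n0, forall n, (n0 <= n)%N -> A <= harm n.
Proof.
exists (Num.truncn (expR A)).+1 => n n0; apply: le_trans (harm_ge_ln n).
rewrite -[A]expRK ler_ln ?posrE ?expR_gt0 ?ltr0n //.
apply: le_trans (ltW (truncnS_gt _)) _.
by rewrite ler_nat; apply: leq_trans n0 _.
Qed.

Lemma negl_linear {R : realType} (K : R) :
  negl (fun n => K * n%:R) (fun n => n%:R * harm n).
Proof.
move=> eps e0; have [n0 Hn0] := harm_unbounded (`|K| / eps).
exists (`|K| * n0%:R) => n; rewrite normrM [X in _ * X]ger0_norm //.
have [nn0|nn0] := leqP n0 n; last first.
  apply: (@le_trans _ _ (`|K| * n0%:R)); first by rewrite ler_wpM2l // ler_nat ltnW.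
  by rewrite lerDr !mulr_ge0 ?harm_ge0 // ltW.
apply: (@le_trans _ _ (eps * (n%:R * harm n))); last by rewrite lerDl mulr_ge0.
have := Hn0 n nn0; rewrite ler_pdivrMr // => H.
rewrite mulrCA mulrC ler_wpM2l //; lra.
Qed.

(** * Square factors and Dirichlet convolutions *)

Definition zsum {R : realType} (P : pred nat) (n : nat) : R :=
  \sum_(1 <= m < n.+1 | P m) (m%:R ^+ 2)^-1.

Lemma zsum_ge1 {R : realType} (P : pred nat) n : P 1%N -> (0 < n)%N -> 1 <= zsum P n :> R.
Proof.
move=> P1; case: n => // n _; rewrite /zsum big_ltn_cond // P1 expr1n invr1 lerDl.
by apply: sumr_ge0 => m _; rewrite invr_ge0 exprn_ge0.
Qed.

Lemma zsum_mono {R : realType} (P : pred nat) : nondecreasing_seq (@zsum R P).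
Proof.
move=> m n mn; rewrite /zsum (@big_cat_nat _ _ _ m.+1 1 n.+1) //= lerDl.
by apply: sumr_ge0 => k _; rewrite invr_ge0 exprn_ge0.
Qed.

Lemma zsum_le_lim {R : realType} (P : pred nat) (z : R) :
  zsum P @ \oo --> z -> forall n, zsum P n <= z.
Proof.
move=> cz n; rewrite -(cvg_lim _ cz) //.
by apply: nondecreasing_cvgn_le; [exact: zsum_mono|apply/cvg_ex; exists z].
Qed.

(* With V and S the weighted sums of f' and f and Z_M the partial sums of z,
   monotonicity of V gives both S(n) <= z V(n) and Z_M V(n) <= S(M^2 n). *)
Lemma log_mean_square_factor {R : realType} (f f' : nat -> R) (P : pred nat) (c z : R) :
  0 <= c -> P 1%N -> (forall k, 0 <= f' k) ->
  (forall n, psum (fun k => f k / k%:R) n =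
     \sum_(1 <= m < n.+1 | P m)
        (m%:R ^+ 2)^-1 * psum (fun k => f' k / k%:R) (n %/ m ^ 2)) ->
  zsum P @ \oo --> z -> log_mean f c -> log_mean f' (c / z).
Proof.
move=> c0 P1 f0 fE cz H eps e0.
set V := psum (fun k => f' k / k%:R).
have V0 n : 0 <= V n by apply: psum_ge0 => k; rewrite divr_ge0.
have Vmono m n : (m <= n)%N -> V m <= V n.
  by move=> mn; apply: psum_mono => // k; rewrite divr_ge0.
have Zz := zsum_le_lim cz.
have z1 : 1 <= z by apply: le_trans (Zz 1%N); exact: zsum_ge1.
have z0 : 0 < z by apply: lt_le_trans z1.
have sq0 (m : nat) : 0 <= (m%:R ^+ 2)^-1 :> R by rewrite invr_ge0 exprn_ge0.
have lo n : psum (fun k => f k / k%:R) n <= z * V n.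
  rewrite fE; apply: (@le_trans _ _ (zsum P n * V n)); last by rewrite ler_wpM2r.
  rewrite /zsum big_distrl /=; apply: ler_sum => m _.
  by rewrite ler_wpM2l // Vmono // leq_div.
have hi M n : (0 < M)%N -> (0 < n)%N ->
    zsum P M * V n <= psum (fun k => f k / k%:R) (M ^ 2 * n).
  move=> M0 n0; rewrite fE (@big_cat_nat _ _ _ M.+1 1) //=; last by rewrite ltnS; nia.
  rewrite ler_wpDr //; first by apply: sumr_ge0 => m _; rewrite mulr_ge0.
  rewrite /zsum big_distrl /= big_nat_cond [X in _ <= X]big_nat_cond.
  apply: ler_sum => m /andP[/andP[m0 mM] _].
  rewrite ler_wpM2l // Vmono // leq_divRL ?expn_gt0 ?m0 //.
  by rewrite mulnC leq_mul2r leq_exp2r // orbC -ltnS mM.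
have e20 : 0 < eps / 2 by lra.
have [M M0 HM] : exists2 M, (0 < M)%N & c / zsum P M <= c / z + eps / 2.
  have : (fun n => c / zsum P n) @ \oo --> c / z.
    by apply: cvgMr; apply: cvgV => //; rewrite gt_eqF.
  move=> /cvgrPdist_le/(_ _ e20)[M _ HM]; exists M.+1 => //.
  have := HM M.+1 (leqnSn M); rewrite /= distrC ler_norml => /andP[_].
  by rewrite lerBlDl.
have [C1 HC1] := H _ e0; have [C2 HC2] := H _ e20.
have C10 : 0 <= C1.
  by have := HC1 0%N; rewrite /harm !psum0 !mulr0 subrr normr0 add0r.
have C20 : 0 <= C2.
  by have := HC2 0%N; rewrite /harm !psum0 !mulr0 subrr normr0 add0r.
(* By [harm_mul] this is the whole cost of replacing [harm (M ^ 2 * n)] by [harm n]; it is constant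
   because M depends on eps alone. *)
pose K : R := ((M ^ 2).-1)%:R.
have K0 : 0 <= K by [].
exists (C1 + (C2 + (c + eps / 2) * K)) => n.
have H0 := @harm_ge0 R n.
have cK : 0 <= (c + eps / 2) * K by apply: mulr_ge0 => //; lra.
have [->|n0] := posnP n.
  rewrite -/V /V /harm !psum0 !mulr0 subrr normr0; lra.
rewrite ler_norml; apply/andP; split.
  have := HC1 n; rewrite ler_norml => /andP[+ _] => L.
  have {}L : c * harm n - (eps * harm n + C1) <= z * V n.
    by have := lo n; move: L; lra.
  have : z^-1 * (c * harm n - (eps * harm n + C1)) <= V n.
    by rewrite -ler_pdivlMl ?invr_gt0 // invrK.
  have : z^-1 * (eps * harm n + C1) <= eps * harm n + C1.
    by rewrite ler_piMl ?invf_le1 // addr_ge0 // mulr_ge0 // ltW.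
  rewrite mulrBr -/V mulrA [z^-1 * c]mulrC; lra.
have ZM1 : 1 <= zsum P M :> R by exact: zsum_ge1.
have ZM0 : 0 < zsum P M :> R by apply: lt_le_trans ZM1.
have yle : (zsum P M : R)^-1 <= 1 by rewrite invf_le1.
have y0 : 0 <= (zsum P M : R)^-1 by rewrite invr_ge0 ltW.
have := HC2 (M ^ 2 * n)%N; rewrite ler_norml => /andP[_ U].
have hM : harm (M ^ 2 * n) <= harm n + K.
  by have := @harm_mul R (M ^ 2).-1 n; rewrite prednK // expn_gt0 M0.
have U2 : zsum P M * V n <= (c + eps / 2) * (harm n + K) + C2.
  apply: le_trans (hi M n M0 n0) _.
  apply: (@le_trans _ _ ((c + eps / 2) * harm (M ^ 2 * n) + C2)); first by lra.
  by rewrite lerD2r ler_wpM2l //; lra.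
have {}U2 : V n <= (zsum P M)^-1 * ((c + eps / 2) * (harm n + K) + C2).
  by rewrite ler_pdivlMl.
rewrite lerBlDl; apply: le_trans U2 _.
have -> : (zsum P M)^-1 * ((c + eps / 2) * (harm n + K) + C2) =
  c / zsum P M * harm n + (zsum P M)^-1 * (eps / 2 * harm n + ((c + eps / 2) * K + C2)).
  by rewrite [c / _]mulrC; ring.
have X1 : c / zsum P M * harm n <= (c / z + eps / 2) * harm n by rewrite ler_wpM2r.
have X2 : (zsum P M)^-1 * (eps / 2 * harm n + ((c + eps / 2) * K + C2)) <=
   eps / 2 * harm n + ((c + eps / 2) * K + C2).
  rewrite ler_piMl // addr_ge0 //; first by rewrite mulr_ge0 // ltW.
  by rewrite addr_ge0.
apply: le_trans (lerD X1 X2) _.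
rewrite mulrDl; lra.
Qed.

(** Replacing the partial sum of g at n / k by c' n / k yields c' n times the logarithmic sum of f.
    The proportional part of the error costs a small multiple of n log n. The additive part,
    including the rounding of n / k, costs a constant times the partial sum of f, which is O(n)
    thanks to B and hence negligible. *)
Lemma dirichlet_mean {R : realType} (f g : nat -> R) (c c' B : R) :
  (forall k, 0 <= f k) -> (forall n, psum f n <= B * n%:R) ->
  log_mean f c -> mean_value g c' ->
  negl (fun n => psum (fun k => f k * psum g (n %/ k)) n - c * c' * (n%:R * harm n))
       (fun n => n%:R * harm n).
Proof.
move=> f0 fB Hf Hg eps e0.
have d0 : 0 < 2 * (`|c| + `|c'| + 1) by have := normr_ge0 c; have := normr_ge0 c'; lra.
(* The error terms of order n log n have coefficients e1 (|c| + 1) from g and |c'| e1 from f,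
   together at most eps / 2. The bound e1 <= 1 is what gives V <= (|c| + 1) [harm n] + C2. *)
pose e1 := Num.min 1 (eps / (2 * (`|c| + `|c'| + 1))).
have e10 : 0 < e1 by rewrite /e1 lt_min ltr01 divr_gt0.
have e11 : e1 <= 1 by rewrite /e1 ge_min lexx.
have e12 : e1 * (`|c| + `|c'| + 1) <= eps / 2.
  have : e1 <= eps / (2 * (`|c| + `|c'| + 1)) by rewrite /e1 ge_min lexx orbT.
  by rewrite ler_pdivlMr //; lra.
have [C1 HC1] := Hg _ e10; have [C2 HC2] := Hf _ e10.
have C10 : 0 <= C1 by have := HC1 0%N; rewrite psum0 !mulr0 subrr normr0 add0r.
have [C3 HC3] := negl_linear (e1 * C2 + `|c'| * C2 + (C1 + `|c'|) * B) (divr_gt0 e0 (ltr0Sn R 1)).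
exists C3 => n; set V := psum (fun k => f k / k%:R) n.
have H0 := @harm_ge0 R n.
have Vle : V <= (`|c| + 1) * harm n + C2.
  have := HC2 n; rewrite ler_norml -/V => /andP[_].
  have : c * harm n <= `|c| * harm n by rewrite ler_wpM2r // ler_norm.
  have : e1 * harm n <= harm n by rewrite ler_piMl.
  by rewrite mulrDl mul1r; lra.
have A1 : `|psum (fun k => f k * psum g (n %/ k)) n - c' * n%:R * V| <=
    e1 * n%:R * V + (C1 + `|c'|) * psum f n.
  have -> : psum (fun k => f k * psum g (n %/ k)) n - c' * n%:R * V =
     psum (fun k => f k * (psum g (n %/ k) - c' * (n%:R / k%:R))) n.
    rewrite /V -mulNr -psumZ -psumD; apply: eq_psum => k _; ring.
  rewrite /V -!psumZ -psumD; apply: ler_norm_psum => k /andP[k0 kn].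
  have k0' : 0 < k%:R :> R by rewrite ltr0n.
  rewrite normrM ger0_norm //.
  have -> : e1 * n%:R * (f k / k%:R) + (C1 + `|c'|) * f k =
     f k * (e1 * (n%:R / k%:R) + (C1 + `|c'|)) by ring.
  rewrite ler_wpM2l //; set m := (n %/ k)%N.
  have m1 : m%:R <= n%:R / k%:R :> R.
    by rewrite ler_pdivlMr // -natrM ler_nat leq_trunc_div.
  have m2 : n%:R / k%:R <= m%:R + 1 :> R.
    by rewrite ler_pdivrMr // natr1 -natrM ler_nat ltnW // ltn_ceil.
  have -> : psum g m - c' * (n%:R / k%:R) =
    (psum g m - c' * m%:R) + c' * (m%:R - n%:R / k%:R) by ring.
  apply: le_trans (ler_normD _ _) _; rewrite [e1 * _ + _]addrA; apply: lerD.
    apply: le_trans (HC1 m) _; rewrite lerD2r ler_wpM2l //; exact: ltW.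
  rewrite normrM -[X in _ <= X]mulr1 ler_wpM2l // ler_norml; lra.
have A2 : `|c' * n%:R * V - c * c' * (n%:R * harm n)| <= `|c'| * n%:R * (e1 * harm n + C2).
  have -> : c' * n%:R * V - c * c' * (n%:R * harm n) = c' * n%:R * (V - c * harm n) by ring.
  rewrite 2!normrM (ger0_norm (ler0n R n)) ler_wpM2l ?mulr_ge0 //.
  exact: HC2.
have -> : psum (fun k => f k * psum g (n %/ k)) n - c * c' * (n%:R * harm n) =
  (psum (fun k => f k * psum g (n %/ k)) n - c' * n%:R * V) +
  (c' * n%:R * V - c * c' * (n%:R * harm n)) by ring.
apply: le_trans (ler_normD _ _) _; apply: le_trans (lerD A1 A2) _.
have X1 : e1 * n%:R * V <= e1 * n%:R * ((`|c| + 1) * harm n + C2).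
  by rewrite ler_wpM2l // mulr_ge0 // ltW.
have X2 : (C1 + `|c'|) * psum f n <= (C1 + `|c'|) * (B * n%:R).
  by rewrite ler_wpM2l ?addr_ge0.
have X3 := le_trans (ler_norm _) (HC3 n).
have X4 : e1 * (`|c| + `|c'| + 1) * (n%:R * harm n) <= eps / 2 * (n%:R * harm n).
  by rewrite ler_wpM2r // mulr_ge0.
have -> : eps * (n%:R * harm n) + C3 =
  eps / 2 * (n%:R * harm n) + (eps / 2 * (n%:R * harm n) + C3) by field.
apply: le_trans (lerD (lerD X1 X2) (lexx _)) _; apply: le_trans (lerD X4 X3).
by rewrite le_eqVlt; apply/orP; left; apply/eqP; ring.
Qed.

(** * Euler's formula and Euler factors *)

Lemma ler_deriv {R : realType} (f df : R -> R) (a b : R) : a <= b ->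
  (forall x : R, is_derive x 1 f (df x)) -> (forall x, a <= x <= b -> 0 <= df x) ->
  f a <= f b.
Proof.
move=> ab Hf Hd.
have cf : {within `[a, b], continuous f}.
  by apply: derivable_within_continuous => x _; have := Hf x => H; apply: ex_derive.
have [c] := MVT_segment ab (fun x _ => Hf x) cf.
rewrite in_itv /= => cab E; rewrite -subr_ge0 E mulr_ge0 ?subr_ge0 //.
exact: Hd.
Qed.

Lemma sin_le_id {R : realType} (x : R) : 0 <= x -> sin x <= x.
Proof.
move=> x0; have := @ler_deriv R (fun y => y - sin y) (fun y => 1 - cos y) 0 x x0.
rewrite sin0 subrr subr_ge0; apply => y _.
by rewrite subr_ge0 cos_le1.
Qed.

(** A division-free form of x <= tan x; the difference of the two sides has derivative y sin y. *)
Lemma mul_cos_le_sin {R : realType} (x : R) : 0 <= x <= pi -> x * cos x <= sin x.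
Proof.
move=> /andP[x0 xpi].
have := @ler_deriv R (fun y => sin y - y * cos y) (fun y => y * sin y) 0 x x0.
rewrite sin0 mul0r subrr subr_ge0; apply => [y|y /andP[y0 yx]]; last first.
  by rewrite mulr_ge0 // sin_ge0_pi // y0 (le_trans yx).
have H := is_deriveB (is_derive_sin y) (is_deriveM (is_derive_id y 1) (is_derive_cos y)).
by apply: is_derive_eq H _; rewrite /GRing.scale /=; ring.
Qed.

(** The identity is cos^2 + sin^2 = 1 at x / 2, divided by sin(x)^2. Writing the cosine as the sine
    of the complementary angle keeps both terms of the same type, ready for iteration. *)
Lemma sin_half_sq {R : realType} (x : R) : sin x != 0 ->
  (sin x ^+ 2)^-1 = ((sin (x / 2) ^+ 2)^-1 + (sin (pi / 2 - x / 2) ^+ 2)^-1) / 4.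
Proof.
have -> : sin (pi / 2 - x / 2) = cos (x / 2).
  by rewrite -opprB sinN sinBpihalf opprK.
have -> : sin x = 2 * (sin (x / 2) * cos (x / 2)).
  have {1}-> : x = (x / 2) *+ 2 by rewrite -mulr_natr divfK.
  by rewrite sin_mulr2n -mulr_natl [cos _ * _]mulrC.
rewrite !mulf_eq0 !negb_or => /and3P[_ s0 c0].
have := cos2Dsin2 (x / 2) => E.
have -> : ((sin (x / 2) ^+ 2)^-1 + (cos (x / 2) ^+ 2)^-1) / 4 =
  (cos (x / 2) ^+ 2 + sin (x / 2) ^+ 2) / (4 * (sin (x / 2) ^+ 2 * cos (x / 2) ^+ 2)).
  by field; rewrite s0 c0.
by rewrite E; field; rewrite s0 c0.
Qed.

(** The odd multiples of pi / 2^(m+2). Passing from x to x / 2 and pi / 2 - x / 2 sends the angle k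
    of level m to the angles k and 2^(m+1) - k - 1 of level m + 1. *)
Definition basel_angle {R : realType} (m k : nat) : R :=
  (2 * k%:R + 1) * pi / (4 * 2 ^+ m).

Lemma basel_angle_itv {R : realType} m k : (k < 2 ^ m)%N ->
  0 < @basel_angle R m k < pi / 2.
Proof.
move=> km; have p0 := @pi_gt0 R; rewrite /basel_angle.
have e0 : 0 < 4 * 2 ^+ m :> R by rewrite mulr_gt0 // exprn_gt0.
have k0 : 0 < 2 * k%:R + 1 :> R by rewrite ltr_wpDl // mulr_ge0.
apply/andP; split; first by rewrite divr_gt0 // mulr_gt0.
rewrite ltr_pdivrMr //.
have : k%:R + 1 <= 2 ^+ m :> R by rewrite natr1 -natrX ler_nat.
move=> K; rewrite mulrC.
have -> : pi / 2 * (4 * 2 ^+ m) = pi * (2 * 2 ^+ m) :> R by field.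
by rewrite ltr_pM2l //; lra.
Qed.

(* Hofbauer's proof of Euler's formula iterates the half-angle identity. *)
Lemma sum_inv_sin_sq {R : realType} m :
  \sum_(0 <= k < 2 ^ m) (sin (@basel_angle R m k) ^+ 2)^-1 = 2 * 4 ^+ m.
Proof.
elim: m => [|m IH].
  rewrite expn0 big_nat1 /basel_angle mulr0 add0r mul1r !expr0 !mulr1.
  have s0 : sin (pi / 2) != 0 :> R by rewrite sin_pihalf oner_eq0.
  have := sin_half_sq s0; rewrite sin_pihalf.
  have -> : pi / 2 - pi / 2 / 2 = pi / 4 :> R by field.
  have -> : pi / 2 / 2 = pi / 4 :> R by field.
  by rewrite expr1n invr1; lra.
rewrite exprS mulrCA -IH big_distrr /=.
transitivity (\sum_(0 <= k < 2 ^ m) ((sin (@basel_angle R m.+1 k) ^+ 2)^-1 +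
    (sin (@basel_angle R m.+1 (2 ^ m.+1 - k.+1)) ^+ 2)^-1)).
  rewrite big_split /= (@big_cat_nat _ _ _ (2 ^ m) 0) //=; last by rewrite leq_exp2l.
  congr (_ + _); rewrite big_nat_rev /= -{1}[(2 ^ m)%N]add0n big_addn.
  have -> : (2 ^ m.+1 - 2 ^ m = 2 ^ m)%N by rewrite expnS; lia.
  apply: eq_bigr => k _.
  by have -> : (2 ^ m + 2 ^ m.+1 - (k + 2 ^ m).+1 = 2 ^ m.+1 - k.+1)%N by lia.
apply: eq_big_nat => k /andP[_ km].
have p0 := @pi_gt0 R.
rewrite [(sin (basel_angle m k) ^+ 2)^-1]sin_half_sq; last first.
  rewrite gt_eqF // sin_gt0_pi //.
  by have /andP[-> /=] := @basel_angle_itv R m k km; lra.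
rewrite mulrC divfK ?pnatr_eq0 //.
have e0 : 2 ^+ m != 0 :> R by rewrite expf_neq0 // pnatr_eq0.
congr ((sin _ ^+ 2)^-1 + (sin _ ^+ 2)^-1); rewrite /basel_angle !exprS.
  by field.
rewrite natrB; last by rewrite expnS; lia.
by rewrite natrX exprS -[k.+1%:R]natr1; field.
Qed.

(** The upper bound is 1 / sin^2 = cot^2 + 1 with cot x <= 1 / x. A gap of 1 per angle adds up to
    2^m, which is small against the total 2 * 4^m of [sum_inv_sin_sq]. *)
Lemma inv_sin_sq_bounds {R : realType} (x : R) : 0 < x < pi / 2 ->
  (x ^+ 2)^-1 <= (sin x ^+ 2)^-1 <= (x ^+ 2)^-1 + 1.
Proof.
move=> /andP[x0 xpi]; have p0 := @pi_gt0 R.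
have s0 : 0 < sin x by rewrite sin_gt0_pi // x0 /=; lra.
have c0 : 0 < cos x by rewrite cos_gt0_pihalf //; lra.
have sx : sin x <= x by apply: sin_le_id; exact: ltW.
have xs : x * cos x <= sin x by apply: mul_cos_le_sin; lra.
apply/andP; split.
  by rewrite lef_pV2 ?posrE ?exprn_gt0 // lerXn2r // nnegrE ltW.
have E := cos2Dsin2 x.
have -> : (sin x ^+ 2)^-1 = cos x ^+ 2 / sin x ^+ 2 + 1.
  rewrite -[X in _ + X](divff (lt0r_neq0 (exprn_gt0 2 s0))) -mulrDl E mul1r //.
rewrite lerD2r ler_pdivrMr ?exprn_gt0 // ler_pdivlMl ?exprn_gt0 // -exprMn.
by rewrite lerXn2r // nnegrE ?mulr_ge0 // ltW.
Qed.

Definition odd_zsum {R : realType} (K : nat) : R :=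
  \sum_(0 <= k < K) ((2 * k%:R + 1) ^+ 2)^-1.

Lemma odd_zsum_bounds {R : realType} m :
  pi ^+ 2 / 8 - pi ^+ 2 / 16 / 2 ^+ m <= @odd_zsum R (2 ^ m) <= pi ^+ 2 / 8.
Proof.
have p0 := @pi_gt0 R.
have e0 : 0 < 2 ^+ m :> R by rewrite exprn_gt0.
have E : \sum_(0 <= k < 2 ^ m) (@basel_angle R m k ^+ 2)^-1 =
    16 * 4 ^+ m / pi ^+ 2 * @odd_zsum R (2 ^ m).
  rewrite /odd_zsum big_distrr /=; apply: eq_bigr => k _.
  have -> : 4 ^+ m = (2 ^+ m) ^+ 2 :> R by rewrite -exprM mulnC exprM; congr (_ ^+ _); ring.
  have k0 : 2 * k%:R + 1 != 0 :> R by rewrite gt_eqF // ltr_wpDl // mulr_ge0.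
  rewrite /basel_angle; move: (@pi R) p0 => p p0; field.
  by rewrite k0 (gt_eqF p0) (gt_eqF e0).
have f0 : 0 < 4 ^+ m :> R by rewrite exprn_gt0.
have f2 : 4 ^+ m = 2 ^+ m * 2 ^+ m :> R by rewrite -exprMn; congr (_ ^+ _); ring.
have L : 16 * 4 ^+ m / pi ^+ 2 * @odd_zsum R (2 ^ m) <= 2 * 4 ^+ m.
  rewrite -E -sum_inv_sin_sq; apply: ler_sum_nat => k /andP[_ km].
  by have /andP[] := inv_sin_sq_bounds (@basel_angle_itv R m k km).
have U : 2 * 4 ^+ m <= 16 * 4 ^+ m / pi ^+ 2 * @odd_zsum R (2 ^ m) + 2 ^+ m.
  have -> : 2 ^+ m = \sum_(0 <= k < 2 ^ m) 1 :> R by rewrite sumr_const_nat subn0 natrX.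
  rewrite -E -sum_inv_sin_sq -big_split /=; apply: ler_sum_nat => k /andP[_ km].
  by have /andP[] := inv_sin_sq_bounds (@basel_angle_itv R m k km).
have q0 : 0 < 16 * 4 ^+ m / pi ^+ 2 :> R.
  by rewrite divr_gt0 ?exprn_gt0 // mulr_gt0.
apply/andP; split; rewrite -(ler_pM2l q0).
  rewrite -[X in _ <= X](addrK (2 ^+ m)); apply: le_trans (lerB U (lexx _)).
  rewrite f2 le_eqVlt; apply/orP; left; apply/eqP.
  move: (@pi R) (2 ^+ m) p0 e0 => p q p0 q0'; field.
  by rewrite (gt_eqF p0) (gt_eqF q0').
apply: le_trans L _; rewrite le_eqVlt; apply/orP; left; apply/eqP.
by move: (@pi R) p0 => p p0; field; rewrite (gt_eqF p0).
Qed.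

Lemma zsumS {R : realType} (P : pred nat) n :
  zsum P n.+1 = zsum P n + (P n.+1)%:R * (n.+1%:R ^+ 2)^-1 :> R.
Proof.
rewrite /zsum big_mkcond big_nat_recr //= -big_mkcond.
by case: (P n.+1); rewrite ?mul1r ?mul0r.
Qed.

Lemma zsum_odd_double {R : realType} K : zsum odd (2 * K) = @odd_zsum R K.
Proof.
elim: K => [|K IH]; first by rewrite muln0 /zsum /odd_zsum !big_geq.
rewrite /odd_zsum big_nat_recr //= -/(odd_zsum K) -IH.
have -> : (2 * K.+1 = (2 * K).+2)%N by lia.
rewrite !zsumS /= negbK oddM /= mul0r addr0 mul1r.
by rewrite -natr1 natrM.
Qed.

Lemma zsum_odd_cvg {R : realType} : @zsum R odd @ \oo --> (pi ^+ 2 / 8 : R).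
Proof.
have p0 := @pi_gt0 R.
apply/cvgrPdist_le => eps e0.
pose m := (Num.truncn (pi ^+ 2 / 16 / eps)).+1.
exists (2 * 2 ^ m)%N => // n /= mn.
have U : zsum odd n <= pi ^+ 2 / 8 :> R.
  have /andP[_] := @odd_zsum_bounds R n; apply: le_trans.
  rewrite -zsum_odd_double; apply: zsum_mono.
  by apply: leq_trans (leq_pmull _ _); rewrite // ltnW // ltn_expl.
have L : pi ^+ 2 / 8 - eps <= zsum odd n :> R.
  apply: (@le_trans _ _ (zsum odd (2 * 2 ^ m))); last exact: zsum_mono.
  rewrite zsum_odd_double.
  have /andP[+ _] := @odd_zsum_bounds R m; apply: le_trans.
  rewrite lerD2l lerN2 ler_pdivrMr ?exprn_gt0 // -ler_pdivrMl // mulrC.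
  apply: le_trans (ltW (truncnS_gt _)) _.
  by rewrite -natrX ler_nat -/m ltnW // ltn_expl.
by rewrite ger0_norm ?subr_ge0 // lerBlDl -lerBlDr.
Qed.

(** The multiples of p form a copy of the same sum, scaled by p^-2 and cut off at n / p, because P
    is insensitive to the factor p. In the limit this removes one Euler factor. *)
Lemma zsum_remove {R : realType} (P : pred nat) p n : (0 < p)%N ->
  (forall m, P (p * m)%N = P m) ->
  zsum (fun m => P m && ~~ (p %| m)%N) n = zsum P n - (p%:R ^+ 2)^-1 * zsum P (n %/ p) :> R.
Proof.
move=> p0 HP; apply/eqP; rewrite eq_sym subr_eq; apply/eqP.
elim: n => [|n IH]; first by rewrite div0n /zsum !big_geq // mulr0 addr0.
rewrite !zsumS IH divnS //; have [/dvdnP[q qE]|_] := boolP (p %| n.+1)%N; last first.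
  by rewrite andbT add0n; ring.
have q0 : (0 < q)%N by case: q qE.
have nq : (n %/ p).+1 = q.
  have := divnS n p0; rewrite qE dvdn_mull // mulnK // => ->; by [].
rewrite andbF add1n zsumS nq mulrDr mul0r addr0 -addrA; congr (_ + (_ + _)).
by rewrite qE mulnC HP natrM exprMn invfM mulrCA.
Qed.

Lemma divn_cvg p : (0 < p)%N -> (fun n => n %/ p)%N @ \oo --> \oo.
Proof.
move=> p0; apply/cvgnyPge => A; exists (A * p)%N => // n /= An.
by rewrite leq_divRL.
Qed.

Lemma zsum_remove_cvg {R : realType} (P : pred nat) p (z : R) : (0 < p)%N ->
  (forall m, P (p * m)%N = P m) -> zsum P @ \oo --> z ->
  zsum (fun m => P m && ~~ (p %| m)%N) @ \oo --> z * (1 - (p%:R ^+ 2)^-1).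
Proof.
move=> p0 HP cz.
have -> : @zsum R (fun m => P m && ~~ (p %| m)%N) =
    fun n => zsum P n - (p%:R ^+ 2)^-1 * zsum P (n %/ p).
  by apply/funext => n; exact: zsum_remove.
have -> : z * (1 - (p%:R ^+ 2)^-1) = z - (p%:R ^+ 2)^-1 * z by ring.
apply: cvgB => //; apply: cvgMr.
exact: (cvg_comp _ _ (divn_cvg p0) cz).
Qed.

Lemma basel {R : realType} : @zsum R predT @ \oo --> (pi ^+ 2 / 6 : R).
Proof.
have oddE : @zsum R odd = zsum (fun m => predT m && ~~ (2 %| m)%N).
  by apply/funext => n; rewrite /zsum; apply: eq_bigl => m; rewrite dvdn2 negbK.
have p0 := @pi_gt0 R.
(* Splitting off the even m gives Z(n) <= pi^2 / 8 + Z(n / 2) / 4, and pi^2 / 6 is the fixed point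
   of this recursion. The bound supplies convergence before the limit is identified. *)
have bnd n : zsum predT n <= pi ^+ 2 / 6 :> R.
  elim/ltn_ind: n => n IH; have [->|n0] := posnP n.
    by rewrite /zsum big_geq // divr_ge0 // exprn_ge0 // ltW.
  have := @zsum_remove R predT 2 n isT (fun=> erefl); rewrite -oddE.
  have := zsum_le_lim (@zsum_odd_cvg R) n.
  have := IH (n %/ 2)%N (ltn_Pdiv (isT : (1 < 2)%N) n0); lra.
have cv : cvgn (@zsum R predT).
  apply: nondecreasing_is_cvgn; first exact: zsum_mono.
  by exists (pi ^+ 2 / 6) => _ [n _ <-].
have [z cz] : exists z : R, zsum predT @ \oo --> z by exists (limn (@zsum R predT)).
have := @zsum_remove_cvg R predT 2 z isT (fun=> erefl) cz; rewrite -oddE => cz'.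
have E : z * (1 - (2%:R ^+ 2)^-1) = pi ^+ 2 / 8.
  by apply: cvg_unique cz' zsum_odd_cvg.
have <- : z = pi ^+ 2 / 6 by move: E; lra.
exact: cz.
Qed.

Lemma zsum_primes_cvg {R : realType} (s : seq nat) : uniq s -> all prime s ->
  zsum (fun m => all (fun p => ~~ (p %| m)%N) s) @ \oo -->
    (pi ^+ 2 / 6 * \prod_(p <- s) (1 - (p%:R ^+ 2)^-1) : R).
Proof.
elim: s => [_ _|p s IH /= /andP[ps us] /andP[pp sp]].
  by rewrite big_nil mulr1; exact: basel.
rewrite big_cons mulrCA [X in _ --> X]mulrC.
have -> : (fun m => ~~ (p %| m)%N && all (fun q => ~~ (q %| m)%N) s) =
    (fun m => all (fun q => ~~ (q %| m)%N) s && ~~ (p %| m)%N).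
  by apply/funext => m; rewrite andbC.
apply: zsum_remove_cvg (IH us sp); first exact: prime_gt0.
move=> m; apply: eq_in_all => q qs; have qp := allP sp q qs.
rewrite Euclid_dvdM // dvdn_prime2 //; case: eqP => // qE.
by move: ps; rewrite -qE qs.
Qed.

Lemma zsum_coprime_cvg {R : realType} D : (0 < D)%N ->
  zsum (fun m => coprime m D) @ \oo -->
    (pi ^+ 2 / 6 * \prod_(p <- primes D) (1 - (p%:R ^+ 2)^-1) : R).
Proof.
move=> D0; have := @zsum_primes_cvg R (primes D) (primes_uniq D).
have -> : all prime (primes D) by apply/allP => p; rewrite mem_primes => /and3P[].
move=> /(_ isT).
suff -> : @zsum R (fun m => coprime m D) =
    zsum (fun m => all (fun p => ~~ (p %| m)%N) (primes D)) by [].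
apply/funext => n; rewrite /zsum big_nat_cond [RHS]big_nat_cond.
apply: eq_bigl => m; case: (boolP (0 < m < n.+1)%N) => //= /andP[m0 _].
rewrite coprime_has_primes // -all_predC; apply: eq_in_all => p pD /=.
by move: pD; rewrite !mem_primes m0 => /and3P[-> _ _].
Qed.

(** * Riemann sums for the quarter circle *)

(* The area under the unit circle above [0, sin t]. *)
Definition sector {R : realType} (t : R) : R := (t + sin t * cos t) / 2.

Lemma is_derive_sector {R : realType} (t : R) : is_derive t 1 (@sector R) (cos t ^+ 2).
Proof.
have H := is_deriveM (is_deriveD (is_derive_id t 1)
  (is_deriveM (is_derive_sin t) (is_derive_cos t))) (is_derive_cst (2^-1 : R) t 1).
apply: is_derive_eq H _; rewrite /GRing.scale /= mulr0 add0r.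
have := cos2Dsin2 t; move: (sin t) (cos t) => s c E.
have -> : 1 + (s * - s + c * c) = 2 * c ^+ 2.
  by transitivity (c ^+ 2 + s ^+ 2 + (s * - s + c * c)); [rewrite E|ring].
by rewrite mulrA mulVf ?mul1r.
Qed.

Lemma cos_mono {R : realType} (x y : R) : 0 <= x -> x <= y -> y <= pi -> cos y <= cos x.
Proof.
move=> x0 xy ypi; have [->//|/eqP xny] := x =P y.
have xly : x < y by rewrite lt_neqAle xny.
rewrite ltW // ltr_cos // in_itv /= ?x0 ?ypi ?andbT ?(le_trans xy) ?(le_trans x0) //.
Qed.

(** Over the abscissa sin t the circle has height cos t, so the strip between sin a and sin b lies
    between rectangles of heights cos b and cos a. Both inequalities follow from the sign of a
    derivative. *)
Lemma sector_bounds {R : realType} (a b : R) : 0 <= a -> a <= b -> b <= pi / 2 ->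
  cos b * (sin b - sin a) <= sector b - sector a <= cos a * (sin b - sin a).
Proof.
move=> a0 ab bpi; have p0 := @pi_gt0 R.
have cos0 x : a <= x <= b -> 0 <= cos x.
  by move=> /andP[ax xb]; apply: cos_ge0_pihalf; lra.
have D (c x : R) : is_derive x 1 (fun t => c * sin t) (c * cos x).
  by apply: is_derive_eq (is_deriveZ c (is_derive_sin x)) _.
apply/andP; split.
  have := @ler_deriv R (fun t => sector t - cos b * sin t)
    (fun t => cos t ^+ 2 - cos b * cos t) a b ab.
  move=> H; have {H} : sector a - cos b * sin a <= sector b - cos b * sin b; last by lra.
  apply: H => [x|x axb]; first exact: (is_deriveB (is_derive_sector x) (D (cos b) x)).
  rewrite expr2 -mulrBl mulr_ge0 ?cos0 // subr_ge0; move/andP: axb => [ax xb].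
  by apply: cos_mono; lra.
have := @ler_deriv R (fun t => cos a * sin t - sector t)
  (fun t => cos a * cos t - cos t ^+ 2) a b ab.
move=> H; have {H} : cos a * sin a - sector a <= cos a * sin b - sector b; last by lra.
apply: H => [x|x axb]; first exact: (is_deriveB (D (cos a) x) (is_derive_sector x)).
rewrite expr2 -mulrBl mulr_ge0 ?cos0 // subr_ge0; move/andP: axb => [ax xb].
by apply: cos_mono; lra.
Qed.

Lemma asin_itv {R : realType} (t : R) : 0 <= t <= 1 -> 0 <= asin t <= pi / 2.
Proof.
move=> /andP[t0 t1]; have p0 := @pi_gt0 R.
have t11 : -1 <= t <= 1 by lra.
rewrite asin_lepi2 // andbT leNgt; apply/negP => H.
have : sin (asin t) < sin 0.
  rewrite ltr_sin // in_itv /=; last by lra.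
  by rewrite asin_geNpi2 // asin_lepi2.
by rewrite sin0 asinK ?in_itv //= ltNge t0.
Qed.

Lemma asin_mono {R : realType} (t u : R) : 0 <= t -> t <= u -> u <= 1 -> asin t <= asin u.
Proof.
move=> t0 tu u1; have p0 := @pi_gt0 R.
have tI : -1 <= t <= 1 by lra.
have uI : -1 <= u <= 1 by lra.
rewrite leNgt; apply/negP => H.
have : sin (asin u) < sin (asin t).
  by rewrite ltr_sin // in_itv /= asin_geNpi2 // asin_lepi2.
by rewrite !asinK ?in_itv //= ltNge tu.
Qed.

(** The sum is a right Riemann sum of step 1 / s, hence a lower one; the left sum exceeds it by at
    most the initial height 1, which is the error term. The condition s <= B + 1 makes the last,
    incomplete strip no wider than a step. *)
Lemma sum_quarter_circle {R : realType} (s : R) (B : nat) : 0 < s -> B%:R <= s ->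
  s <= B%:R + 1 ->
  pi / 4 * s - 1 <= psum (fun b => Num.sqrt (1 - (b%:R / s) ^+ 2)) B <= pi / 4 * s.
Proof.
move=> s0 Bs sB; have p0 := @pi_gt0 R.
pose c (b : nat) : R := Num.sqrt (1 - (b%:R / s) ^+ 2).
pose t (b : nat) : R := b%:R / s.
have tI b : (b <= B)%N -> 0 <= t b <= 1.
  move=> bB; rewrite /t divr_ge0 ?(ltW s0) //= ler_pdivrMr // mul1r.
  by apply: le_trans Bs; rewrite ler_nat.
have t1 b : (b <= B)%N -> -1 <= t b <= 1 by move=> /tI/andP[]; lra.
have cE b : (b <= B)%N -> cos (asin (t b)) = c b by move=> /t1; exact: cos_asin.
have sE b : (b <= B)%N -> sin (asin (t b)) = t b.
  by move=> /t1 H; rewrite asinK // in_itv.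
have aI b : (b <= B)%N -> 0 <= asin (t b) <= pi / 2 by move=> /tI; exact: asin_itv.
have tS b : t b.+1 - t b = s^-1 by rewrite /t -natr1; ring.
have step b : (b < B)%N ->
    c b.+1 / s <= sector (asin (t b.+1)) - sector (asin (t b)) <= c b / s.
  move=> bB; have bB' := ltnW bB.
  have /andP[a0 _] := aI b bB'; have /andP[_ a1] := aI b.+1 bB.
  have ab : asin (t b) <= asin (t b.+1).
    have /andP[x0 _] := tI b bB'; have /andP[_ x1] := tI b.+1 bB.
    by apply: asin_mono => //; rewrite -subr_ge0 tS invr_ge0 ltW.
  by have := sector_bounds a0 ab a1; rewrite !cE // !sE // tS.
have c0 : c 0%N = 1 by rewrite /c mul0r expr0n subr0 sqrtr1.
have F0 : sector (asin (t 0%N)) = 0.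
  have E : asin (t 0%N) = 0.
    rewrite /t mul0r -{1}(@sin0 R) sinK // in_itv /=; lra.
  by rewrite /sector E sin0 mul0r addr0 mul0r.
have up b : (b <= B)%N -> psum c b / s <= sector (asin (t b)).
  elim: b => [|b IH] bB; first by rewrite psum0 mul0r F0.
  rewrite psumS mulrDl; have /andP[H _] := step b bB; have := IH (ltnW bB); lra.
have lo b : (b <= B)%N -> sector (asin (t b)) <= (1 + psum c b - c b) / s.
  elim: b => [|b IH] bB; first by rewrite psum0 F0 c0 addr0 subrr mul0r.
  rewrite psumS; have /andP[_ H] := step b bB; have := IH (ltnW bB).
  have -> : (1 + (psum c b + c b.+1) - c b.+1) / s = (1 + psum c b - c b) / s + c b / s.
    by ring.
  by lra.
have Fpi : sector (pi / 2) = pi / 4 :> R.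
  by rewrite /sector cos_pihalf mulr0 addr0; field.
have /andP[a0 a1] := aI B (leqnn B).
have := sector_bounds a0 a1 (lexx _).
rewrite cos_pihalf mul0r Fpi sin_pihalf cE // sE // => /andP[H1 H2].
have si : 0 < s^-1 by rewrite invr_gt0.
have cB : 0 <= c B by rewrite /c sqrtr_ge0.
have H3 : c B * (1 - t B) <= c B / s.
  rewrite ler_wpM2l // lerBlDl /t -{1}(divff (lt0r_neq0 s0)) -[X in _ <= _ + X]mul1r -mulrDl.
  by rewrite ler_pM2r.
have U := up B (leqnn B); have L := lo B (leqnn B).
rewrite -/c; apply/andP; split.
  have : pi / 4 <= (1 + psum c B) / s.
    have -> : (1 + psum c B) / s = (1 + psum c B - c B) / s + c B / s by ring.
    by lra.
  by rewrite ler_pdivlMr //; lra.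
have : psum c B / s <= pi / 4 by lra.
by rewrite ler_pdivrMr.
Qed.

(** * Lattice points in ellipses *)

(** Along a row or column the points inside an ellipse form an initial segment. Its length stays
    abstract instead of being a floor of a square root, and is compared with the root only where
    sizes matter. *)
Lemma initial_segment (D : pred nat) M : (forall x y, (x <= y)%N -> D y -> D x) ->
  exists2 K, (K <= M)%N & forall x, (x < M)%N -> D x = (x < K)%N.
Proof.
move=> Dcl; elim: M => [|M [K KM HK]]; first by exists 0%N.
have [DM|nDM] := boolP (D M).
  by exists M.+1 => // x xM; rewrite xM; apply: Dcl DM.
exists K; first exact: leqW.
move=> x; rewrite ltnS leq_eqVlt => /orP[/eqP ->|]; last exact: HK.
by rewrite (negbTE nDM) ltnNge KM.
Qed.

Lemma sum_initial_segment {R : realType} (F : nat -> R) (D : pred nat) K M : (K <= M)%N ->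
  (forall x, (x < M)%N -> D x = (x < K)%N) ->
  \sum_(0 <= x < M) F x * (D x)%:R = \sum_(0 <= x < K) F x.
Proof.
move=> KM HD; rewrite (@big_cat_nat _ _ _ K) //= [X in _ + X]big_nat_cond.
rewrite [X in _ + X]big1 ?addr0.
  apply: eq_big_nat => x /andP[_ xK].
  by rewrite HD ?xK ?mulr1 //; exact: leq_trans KM.
move=> x /andP[/andP[Kx xM] _]; rewrite HD // ltnNge Kx mulr0 //.
Qed.

Definition sw {R : realType} (k : nat) : R := (sign_weight k)%:R.

Lemma sw_ge0 {R : realType} k : 0 <= sw k :> R.
Proof. exact: ler0n. Qed.

Lemma sum_sw {R : realType} K : \sum_(0 <= x < K.+1) sw x = 2 * K%:R + 1 :> R.
Proof.
elim: K => [|K IH]; first by rewrite big_nat1 mulr0 add0r.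
by rewrite big_nat_recr //= IH /sw /sign_weight -natr1; ring.
Qed.

Lemma sum_sw_shift {R : realType} (h : nat -> R) K :
  \sum_(0 <= x < K.+1) sw x * h x = 2 * (\sum_(0 <= x < K.+1) h x) - h 0%N.
Proof.
rewrite big_nat_recl // [X in _ = 2 * X - _]big_nat_recl // /sw /sign_weight /= mul1r.
by rewrite mulrDr big_distrr /=; ring.
Qed.

Lemma le_sqrt_nat {R : realType} (k n f : nat) : (0 < f)%N -> (f * k ^ 2 <= n)%N ->
  k%:R <= Num.sqrt n%:R :> R.
Proof.
move=> f0 fkn; rewrite -(@ler_pXn2r _ 2) ?nnegrE ?sqrtr_ge0 // sqr_sqrtr // -natrX ler_nat.
by apply: leq_trans fkn; apply: leq_pmull.
Qed.

Lemma sum_sw_sqrt {R : realType} (f n M : nat) : (0 < f)%N ->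
  \sum_(0 <= y < M) sw y * (f * y ^ 2 <= n)%N%:R <= 2 * (Num.sqrt n%:R + 1) :> R.
Proof.
move=> f0; have q0 : 0 <= Num.sqrt n%:R :> R by rewrite sqrtr_ge0.
have [|K KM HK] := @initial_segment (fun y => f * y ^ 2 <= n)%N M.
  by move=> x y xy; apply: leq_trans; rewrite leq_mul2l leq_exp2r // xy orbT.
rewrite (sum_initial_segment _ KM HK); case: K KM HK => [|K] KM HK.
  by rewrite big_geq //; lra.
have := HK K KM; rewrite ltnSn => /(le_sqrt_nat (R := R) f0).
by rewrite sum_sw; lra.
Qed.

Definition lattice {R : realType} (e f : nat) (a b : nat -> R) (n : nat) : R :=
  \sum_(0 <= x < n.+1) \sum_(0 <= y < n.+1)
    sw x * a x * (sw y * b y) * (qform e f x y <= n)%N%:R.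

Lemma latticeC {R : realType} e f (a b : nat -> R) n :
  lattice e f a b n = lattice f e b a n.
Proof.
rewrite /lattice exchange_big /=; apply: eq_bigr => y _; apply: eq_bigr => x _.
by rewrite /qform addnC; congr (_ * _); rewrite mulrC.
Qed.

(** Every row meets the ellipse in an initial segment, over which a - th has bounded weighted sum,
    and only O(sqrt n) rows meet the ellipse at all. So a weight may be replaced by its density at
    cost O(sqrt n). *)
Lemma lattice_compare {R : realType} e f (a b : nat -> R) (th C : R) n :
  (0 < e)%N -> (0 < f)%N ->
  (forall K, `|\sum_(0 <= x < K) sw x * (a x - th)| <= C) ->
  (forall y, `|b y| <= 1) ->
  `|lattice e f a b n - th * lattice e f (fun=> 1) b n| <= 2 * C * (Num.sqrt n%:R + 1).
Proof.
move=> e0 f0 HC b1.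
have C0 : 0 <= C by apply: le_trans (HC 0%N); rewrite normr_ge0.
have -> : lattice e f a b n - th * lattice e f (fun=> 1) b n =
  \sum_(0 <= y < n.+1) sw y * b y *
    \sum_(0 <= x < n.+1) sw x * (a x - th) * (qform e f x y <= n)%N%:R.
  rewrite /lattice exchange_big [X in _ - _ * X]exchange_big /= big_distrr -sumrB /=.
  apply: eq_bigr => y _; rewrite big_distrr [in RHS]big_distrr -sumrB /=.
  by apply: eq_bigr => x _; ring.
apply: le_trans (ler_norm_sum _ _ _) _.
apply: (@le_trans _ _ (\sum_(0 <= y < n.+1) C * (sw y * (f * y ^ 2 <= n)%N%:R))).
  apply: ler_sum => y _; rewrite !normrM (ger0_norm (sw_ge0 y)).
  have [fy|fy] := boolP (f * y ^ 2 <= n)%N; last first.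
    have -> : \sum_(0 <= x < n.+1) sw x * (a x - th) * (qform e f x y <= n)%N%:R = 0.
      apply: big1 => x _; suff /negbTE -> : ~~ (qform e f x y <= n)%N by rewrite mulr0.
      by apply: contra fy; apply: leq_trans; rewrite /qform leq_addl.
    by rewrite normr0 !mulr0.
  have [|K KM HK] := @initial_segment (fun x => qform e f x y <= n)%N n.+1.
    move=> x x' xx'; apply: leq_trans.
    by rewrite /qform leq_add2r leq_mul2l leq_exp2r // xx' orbT.
  rewrite (sum_initial_segment (fun x => sw x * (a x - th)) KM HK).
  rewrite mulr1 [C * _]mulrC; apply: ler_pM => //; first by rewrite mulr_ge0 ?sw_ge0.
  by rewrite ler_piMr ?sw_ge0.
rewrite -big_distrr /= -mulrA mulrCA; apply: ler_wpM2l => //.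
exact: sum_sw_sqrt.
Qed.

(** The deviation from the density has period A and sum zero over a period, so its sums over initial
    segments are bounded by A; the sign weights double this and count the origin separately. *)
Lemma coprime_density {R : realType} A : (0 < A)%N -> exists C : R, forall K,
  `|\sum_(0 <= x < K) sw x * ((coprime x A)%:R - (totient A)%:R / A%:R)| <= C.
Proof.
move=> A0; have A0' : 0 < A%:R :> R by rewrite ltr0n.
pose th : R := (totient A)%:R / A%:R.
pose h (x : nat) : R := (coprime x A)%:R - th.
have tA : (totient A <= A)%N.
  rewrite totient_count_coprime; apply: (@leq_trans (\sum_(0 <= d < A) 1)).
    by apply: leq_sum => d _; case: coprime.
  by rewrite sum_nat_const_nat muln1 subn0.
have th01 : 0 <= th <= 1.
  by rewrite /th divr_ge0 //= ler_pdivrMr // mul1r ler_nat.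
have h1 x : `|h x| <= 1.
  by rewrite /h ler_norml; case: coprime => /=; lra.
have hA x : h (A + x)%N = h x by rewrite /h ![coprime _ A]coprime_sym /coprime gcdnDl.
have sA : \sum_(0 <= x < A) h x = 0.
  rewrite sumrB sumr_const_nat subn0 -natr_sum.
  have -> : (\sum_(0 <= x < A) coprime x A = totient A)%N.
    by rewrite totient_count_coprime; apply: eq_bigr => d _; rewrite coprime_sym.
  have -> : th *+ A = th * A%:R by rewrite mulr_natr.
  by rewrite /th divfK ?subrr // gt_eqF.
have bnd K : `|\sum_(0 <= x < K) h x| <= A%:R.
  elim/ltn_ind: K => K IH; have [AK|KA] := leqP A K.
    rewrite (@big_cat_nat _ _ _ A) //= sA add0r -{1}[A]add0n big_addn.
    under eq_bigr => x _ do rewrite addnC hA.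
    by apply: IH; lia.
  apply: le_trans (ler_norm_sum _ _ _) _.
  apply: (@le_trans _ _ (\sum_(0 <= x < K) 1)); first by apply: ler_sum.
  by rewrite sumr_const_nat subn0 ler_nat ltnW.
exists (2 * A%:R + 1); case => [|K].
  by rewrite big_geq // normr0; lra.
rewrite -/th (sum_sw_shift h); apply: le_trans (ler_normB _ _) _.
rewrite normrM ger0_norm //; apply: lerD => //.
by rewrite ler_wpM2l.
Qed.

(** A row has 2 K + 1 points, with K within 1 of the half-width [sy y]; replacing the count by twice
    the half-width costs at most 1 per row. The half-widths then form a Riemann sum for the ellipse,
    rescaled to a circle. *)
Lemma lattice_ellipse {R : realType} e f n : (0 < e)%N -> (0 < f)%N ->
  `|lattice e f (fun=> 1) (fun=> 1) n - pi / Num.sqrt (e * f)%:R * n%:R| <=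
  8 * (Num.sqrt n%:R + 1) :> R.
Proof.
move=> e0 f0; set q : R := Num.sqrt n%:R.
have q0 : 0 <= q by rewrite sqrtr_ge0.
have e1 : 1 <= e%:R :> R by rewrite ler1n.
have f1 : 1 <= f%:R :> R by rewrite ler1n.
have [n0|n0] := posnP n.
  rewrite /q n0 /lattice !big_nat1 /sw /sign_weight /qform /= mulr0 subr0.
  by rewrite !muln0 !mulr1 normr1 sqrtr0; lra.
have n0' : 0 < n%:R :> R by rewrite ltr0n.
pose sy (y : nat) : R := Num.sqrt ((n%:R - f%:R * y%:R ^+ 2) / e%:R).
have step1 : `|lattice e f (fun=> 1) (fun=> 1) n -
    \sum_(0 <= y < n.+1) sw y * (2 * sy y) * (f * y ^ 2 <= n)%N%:R| <= 2 * (q + 1).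
  rewrite /lattice exchange_big -sumrB /=.
  apply: le_trans (ler_norm_sum _ _ _) _.
  apply: le_trans (@sum_sw_sqrt R f n n.+1 f0).
  apply: ler_sum => y _.
  have -> : \sum_(0 <= x < n.+1) sw x * 1 * (sw y * 1) * (qform e f x y <= n)%N%:R =
    sw y * \sum_(0 <= x < n.+1) sw x * (qform e f x y <= n)%N%:R :> R.
    by rewrite big_distrr /=; apply: eq_bigr => x _; ring.
  rewrite -mulrA -mulrBr normrM (ger0_norm (sw_ge0 y)) ler_wpM2l ?sw_ge0 //.
  have [fy|fy] := boolP (f * y ^ 2 <= n)%N; last first.
    rewrite mulr0 subr0 big1 ?normr0 // => x _.
    suff /negbTE -> : ~~ (qform e f x y <= n)%N by rewrite mulr0.
    by apply: contra fy; apply: leq_trans; rewrite /qform leq_addl.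
  have [|K KM HK] := @initial_segment (fun x => qform e f x y <= n)%N n.+1.
    move=> x x' xx'; apply: leq_trans.
    by rewrite /qform leq_add2r leq_mul2l leq_exp2r // xx' orbT.
  rewrite (sum_initial_segment (fun x => sw x) KM HK).
  case: K KM HK => [|K] KM HK.
    by have := HK 0%N isT; rewrite /qform muln0 add0n fy.
  have fyR : f%:R * y%:R ^+ 2 <= n%:R :> R by rewrite -natrX -natrM ler_nat.
  have ee : 0 < e%:R :> R by rewrite ltr0n.
  have z0 : 0 <= (n%:R - f%:R * y%:R ^+ 2) / e%:R :> R.
    by rewrite divr_ge0 // subr_ge0.
  have K1 : K%:R <= sy y.
    have := HK K KM; rewrite ltnSn => DK.
    rewrite -(@ler_pXn2r _ 2) ?nnegrE ?sqrtr_ge0 // sqr_sqrtr //.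
    rewrite ler_pdivlMr // lerBrDr mulrC -!natrX -!natrM -natrD ler_nat //.
  have K2 : sy y <= K%:R + 1.
    rewrite natr1 leNgt; apply/negP => H.
    have DK : (qform e f K.+1 y <= n)%N.
      rewrite /qform -(ler_nat R) natrD (natrM _ e) (natrM _ f) !natrX -lerBrDr mulrC -ler_pdivlMr //.
      rewrite -(sqr_sqrtr z0) ler_pXn2r ?nnegrE ?sqrtr_ge0 //; exact: ltW.
    have /andP[Kn _] := qform_ge K.+1 y e0 f0.
    have := HK K.+1; rewrite DK ltnn; rewrite ltnS (leq_trans Kn DK).
    by move=> /(_ isT).
  move: (sy y) K1 K2 => z K1 K2; rewrite mulr1 sum_sw ler_norml mulr1n.
  by clear -K1 K2; lra.
have [|K KM HK] := @initial_segment (fun y => f * y ^ 2 <= n)%N n.+1.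
  by move=> x y xy; apply: leq_trans; rewrite leq_mul2l leq_exp2r // xy orbT.
case: K KM HK => [|B] KM HK.
  by have := HK 0%N isT; rewrite muln0.
have ee : 0 < e%:R :> R by rewrite ltr0n.
have ff : 0 < f%:R :> R by rewrite ltr0n.
pose s : R := Num.sqrt (n%:R / f%:R).
have s0 : 0 < s by rewrite sqrtr_gt0 divr_gt0.
have s2 : s ^+ 2 = n%:R / f%:R by rewrite sqr_sqrtr // divr_ge0.
have Bs : B%:R <= s.
  have := HK B KM; rewrite ltnSn => DB.
  rewrite -(@ler_pXn2r _ 2) ?nnegrE ?(ltW s0) // s2 ler_pdivlMr //.
  by rewrite mulrC -natrX -natrM ler_nat.
have sB : s <= B%:R + 1.
  rewrite natr1 leNgt; apply/negP => H.
  have DB : (f * B.+1 ^ 2 <= n)%N.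
    rewrite -(ler_nat R) natrM natrX mulrC -ler_pdivlMr // -s2.
    by rewrite ler_pXn2r ?nnegrE ?(ltW s0) // ltW.
  have Bn : (B.+1 <= n)%N by apply: leq_trans DB; nia.
  by have := HK B.+1; rewrite ltnS Bn DB ltnn => /(_ isT).
have := sum_quarter_circle s0 Bs sB; set S := psum _ B => /andP[S1 S2].
have syE y : sy y = Num.sqrt (n%:R / e%:R) * Num.sqrt (1 - (y%:R / s) ^+ 2).
  rewrite -sqrtrM ?divr_ge0 //; congr Num.sqrt.
  by rewrite expr_div_n s2; field; rewrite !gt_eqF.
set r : R := Num.sqrt (n%:R / e%:R).
have r0 : 0 <= r by rewrite sqrtr_ge0.
have rq : r <= q.
  by rewrite ler_sqrt // ler_pdivrMr // ler_peMr.
(* The row y = 0 gives 2 r, and each pair of rows at heights y and -y gives 4 r times a height of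
   the unit circle. Since S is pi s / 4 up to 1 and r s = n / sqrt(e f), the area term appears with
   an error O(r). *)
have main : \sum_(0 <= y < n.+1) sw y * (2 * sy y) * (f * y ^ 2 <= n)%N%:R =
   2 * r + 4 * r * S.
  rewrite (sum_initial_segment (fun y => sw y * (2 * sy y)) KM HK).
  rewrite big_nat_recl // /sw /sign_weight /= mul1r syE mul0r expr0n subr0 sqrtr1 mulr1.
  congr (_ + _); rewrite /S /psum big_add1 /= big_distrr /=; apply: eq_bigr => y _.
  by rewrite syE -/r; ring.
have rs : pi / Num.sqrt (e * f)%:R * n%:R = pi * (r * s) :> R.
  rewrite -sqrtrM ?divr_ge0 //.
  have -> : n%:R / e%:R * (n%:R / f%:R) = n%:R ^+ 2 / (e * f)%:R :> R.
    by rewrite natrM; field; rewrite !gt_eqF.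
  rewrite sqrtrM ?exprn_ge0 // sqrtr_sqr ger0_norm // sqrtrV //; ring.
have b1 : `|(2 * r + 4 * r * S) - pi / Num.sqrt (e * f)%:R * n%:R| <= 6 * q.
  rewrite rs.
  have -> : 2 * r + 4 * r * S - pi * (r * s) = 2 * r + 4 * (r * (S - pi / 4 * s)) by field.
  have L : - r <= r * (S - pi / 4 * s).
    by rewrite -[X in - X]mulr1 -mulrN ler_wpM2l //; lra.
  have U : r * (S - pi / 4 * s) <= 0 by rewrite mulr_ge0_le0 //; lra.
  by rewrite ler_norml; lra.
rewrite main in step1.
have -> : lattice e f (fun=> 1) (fun=> 1) n - pi / Num.sqrt (e * f)%:R * n%:R =
  (lattice e f (fun=> 1) (fun=> 1) n - (2 * r + 4 * r * S)) +
  ((2 * r + 4 * r * S) - pi / Num.sqrt (e * f)%:R * n%:R) by ring.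
apply: le_trans (ler_normD _ _) _; move: step1 b1; lra.
Qed.

Lemma lattice_cop {R : realType} e f A B : (0 < e)%N -> (0 < f)%N ->
  (0 < A)%N -> (0 < B)%N ->
  exists C : R, forall n,
  `|lattice e f (fun x => (coprime x A)%:R) (fun y => (coprime y B)%:R) n -
    pi / Num.sqrt (e * f)%:R * ((totient A)%:R / A%:R) * ((totient B)%:R / B%:R) * n%:R|
   <= C * (Num.sqrt n%:R + 1).
Proof.
move=> e0 f0 A0 B0.
have [CA HA] := @coprime_density R A A0; have [CB HB] := @coprime_density R B B0.
set tA := (totient A)%:R / A%:R in HA *; set tB := (totient B)%:R / B%:R in HB *.
exists (2 * CA + `|tA| * (2 * CB) + `|tA * tB| * 8) => n.
set q : R := Num.sqrt n%:R.
have q0 : 0 <= q by rewrite sqrtr_ge0.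
set L := lattice e f _ _ n.
have b1 y : `|(coprime y B)%:R : R| <= 1 by case: coprime; rewrite ?normr1 ?normr0.
have H1 := lattice_compare n e0 f0 HA b1; rewrite -/q -/L in H1.
have n1 : `|1 : R| <= 1 by rewrite normr1.
have H2 := lattice_compare n f0 e0 HB (fun=> n1).
have H3 := @lattice_ellipse R e f n e0 f0.
rewrite -/q in H3; rewrite -/q latticeC [X in _ - _ * X]latticeC in H2.
move: H1 H2 H3; set L2 := lattice e f (fun=> 1) (fun y => (coprime y B)%:R) n.
set L3 := lattice e f (fun=> 1) (fun=> 1) n; set p := pi / _ => H1 H2 H3.
have -> : L - p * tA * tB * n%:R =
  (L - tA * L2) + (tA * (L2 - tB * L3) + tA * tB * (L3 - p * n%:R)) by ring.
have -> : (2 * CA + `|tA| * (2 * CB) + `|tA * tB| * 8) * (q + 1) =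
  2 * CA * (q + 1) + (`|tA| * (2 * CB * (q + 1)) + `|tA * tB| * (8 * (q + 1))) by ring.
apply: le_trans (ler_normD _ _) _; apply: lerD => //.
apply: le_trans (ler_normD _ _) _; apply: lerD.
  by rewrite normrM ler_wpM2l.
by rewrite normrM ler_wpM2l.
Qed.

Lemma sqrt_error_mean {R : realType} (f : nat -> R) (c K : R) :
  (forall n, `|psum f n - c * n%:R| <= K * (Num.sqrt n%:R + 1)) -> mean_value f c.
Proof.
move=> H eps e0; have k0 : 0 < `|K| + 1 by have := normr_ge0 K; lra.
pose d := eps / (`|K| + 1); have d0 : 0 < d by rewrite divr_gt0.
exists ((`|K| + 1) * (d^-1 + 1)) => n; apply: le_trans (H n) _.
set q := Num.sqrt n%:R; have q0 : 0 <= q by rewrite sqrtr_ge0.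
have q2 : q ^+ 2 = n%:R by rewrite sqr_sqrtr.
have di : 0 < d^-1 by rewrite invr_gt0.
(* Either q <= 1 / d, or d q > 1 and then q <= d q^2 = d n. *)
have qd : q <= d * n%:R + d^-1.
  have [qd|qd] := leP q d^-1.
    by rewrite ler_wpDl // mulr_ge0 // ltW.
  rewrite ler_wpDr ?(ltW di) // -q2 expr2 mulrA ler_peMl //.
  by rewrite mulrC -ler_pdivrMr // mul1r ltW.
apply: (@le_trans _ _ ((`|K| + 1) * (q + 1))).
  apply: ler_wpM2r; first by lra.
  by have := ler_norm K; lra.
have -> : eps * n%:R + (`|K| + 1) * (d^-1 + 1) = (`|K| + 1) * (d * n%:R + d^-1 + 1).
  have E : (`|K| + 1) * d = eps by rewrite /d mulrC divfK // gt_eqF.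
  by rewrite -E; ring.
by rewrite ler_wpM2l ?(ltW k0) // lerD2r.
Qed.

(** Partial sums start at k = 1, whereas the lattice count includes the origin, which has value 0;
    the term [P 0 0] accounts for it. *)
Lemma sum_reps e f P n : (0 < e)%N -> (0 < f)%N ->
  (\sum_(1 <= k < n.+1) reps e f P k + P 0 0 = \sum_(0 <= x < n.+1) \sum_(0 <= y < n.+1)
     sign_weight x * sign_weight y * (P x y && (qform e f x y <= n)))%N.
Proof.
move=> e0 f0.
have -> : (P 0 0 : nat) = reps e f P 0.
  by rewrite /reps !big_nat1 /qform !muln0 /= andbT mul1n.
rewrite addnC -big_ltn //.
transitivity (\sum_(0 <= k < n.+1) \sum_(0 <= x < n.+1) \sum_(0 <= y < n.+1)
     sign_weight x * sign_weight y * (P x y && (qform e f x y == k)))%N.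
  by apply: eq_big_nat => k /andP[_ kn]; apply: reps_box.
rewrite exchange_big /=; apply: eq_bigr => x _.
rewrite exchange_big /=; apply: eq_bigr => y _.
rewrite -big_distrr /=; congr muln.
case: (P x y) => /=; last by rewrite big1.
have [qn|qn] := leqP (qform e f x y) n.
  have := @sum_nat_eq (fun=> 1%N) (qform e f x y) 0 n.+1; rewrite ltnS qn /= => E.
  rewrite -[RHS]E //.
  by apply: eq_bigr => k _; rewrite muln1.
rewrite big_nat_cond big1 // => k /andP[/andP[_ kn] _].
by apply/eqP; rewrite eqb0; apply/eqP => E; lia.
Qed.

Lemma reps_mean {R : realType} e f A B : (0 < e)%N -> (0 < f)%N ->
  (0 < A)%N -> (0 < B)%N ->
  mean_value (fun k => (reps e f (cop A B) k)%:R : R)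
   (pi / Num.sqrt (e * f)%:R * ((totient A)%:R / A%:R) * ((totient B)%:R / B%:R)).
Proof.
move=> e0 f0 A0 B0; have [C HC] := @lattice_cop R e f A B e0 f0 A0 B0.
apply: (@sqrt_error_mean _ _ _ (C + 1)) => n.
have := HC n; set L := lattice _ _ _ _ _; set c := _ * _ * (_ / _).
have q0 : 0 <= Num.sqrt n%:R :> R by rewrite sqrtr_ge0.
have LE : L = psum (fun k => (reps e f (cop A B) k)%:R) n + (cop A B 0 0)%:R.
  rewrite /psum -natr_sum -natrD sum_reps // natr_sum; apply: eq_bigr => x _.
  rewrite natr_sum; apply: eq_bigr => y _; rewrite /sw /cop !natrM.
  by case: (coprime x A); case: (coprime y B); rewrite /= ?mulr1 ?mulr0 ?mul0r.
rewrite LE => H.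
have -> : psum (fun k => (reps e f (cop A B) k)%:R) n - c * n%:R =
  psum (fun k => (reps e f (cop A B) k)%:R) n + (cop A B 0 0)%:R - c * n%:R
   - (cop A B 0 0)%:R by ring.
apply: le_trans (ler_normB _ _) _; rewrite mulrDl mul1r; apply: lerD => //.
by case: cop; rewrite ?normr1 ?normr0; lra.
Qed.

(** * Primitive representations *)

Lemma sum_multiples (F : nat -> nat) m X : (0 < m)%N ->
  (forall x, F x != 0 -> (m %| x) && (x <= X))%N ->
  (\sum_(0 <= x < X.+1) F x = \sum_(0 <= x < X.+1) F (m * x))%N.
Proof.
move=> m0 HF.
transitivity (\sum_(0 <= x < X.+1) \sum_(0 <= z < X.+1) (m * z == x) * F x)%N.
  apply: eq_big_nat => x /andP[_ xX].
  have [->|Fx] := eqVneq (F x) 0%N; first by rewrite big1 // => z _; rewrite muln0.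
  have /andP[/dvdnP[z xE] _] := HF x Fx.
  rewrite -[LHS](@sum_nat_eq (fun=> F x) z 0 X.+1); last by nia.
  apply: eq_bigr => y _; congr (nat_of_bool _ * _)%N.
  by rewrite xE [(z * m)%N]mulnC eqn_pmul2l // eq_sym.
rewrite exchange_big /=; apply: eq_bigr => z _.
have [mz|mz] := leqP (m * z) X; first by rewrite sum_nat_eq.
rewrite big_nat_cond big1.
  have [->//|Fx] := eqVneq (F (m * z)%N) 0%N.
  by have /andP[_] := HF _ Fx; rewrite leqNgt mz.
move=> x /andP[/andP[_ xX] _]; case: eqP => // E.
by move: mz; rewrite E ltnNge -ltnS xX.
Qed.

Lemma sign_weightM m x : (0 < m)%N -> sign_weight (m * x) = sign_weight x.
Proof. by move=> m0; rewrite /sign_weight muln_eq0 eqn0Ngt m0. Qed.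

Lemma qformM e f m x y : qform e f (m * x) (m * y) = (m ^ 2 * qform e f x y)%N.
Proof. by rewrite /qform !expnMn; lia. Qed.

(** Sorting by m = gcd(x, y), which is positive as n > 0. The conditions [cop A B] hold for m times
    a primitive point exactly when m is prime to A B and they hold for the primitive point. The
    bound X, common to all n, allows later exchanges of sums. *)
Lemma reps_prim e f A B n X : (0 < e)%N -> (0 < f)%N -> (0 < n)%N -> (n <= X)%N ->
  (reps e f (cop A B) n = \sum_(1 <= m < X.+1 | coprime m (A * B))
     \sum_(1 <= k < X.+1) (m ^ 2 * k == n) * reps e f (prim A B) k)%N.
Proof.
move=> e0 f0 n0 nX; rewrite (reps_box _ e0 f0 nX).
pose G x y := (sign_weight x * sign_weight y * (cop A B x y && (qform e f x y == n)))%N.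
have GX x y : G x y != 0%N -> [&& qform e f x y == n, x <= X & y <= X]%N.
  rewrite /G; case: (qform e f x y =P n) => [E _|]; last by rewrite andbF muln0.
  have := qform_ge x y e0 f0; rewrite E => /andP[xn yn].
  by rewrite (leq_trans xn nX) (leq_trans yn nX).
transitivity (\sum_(1 <= m < X.+1) \sum_(0 <= x < X.+1) \sum_(0 <= y < X.+1)
    (gcdn x y == m) * G x y)%N.
  rewrite [RHS]exchange_big /=; apply: eq_bigr => x _.
  rewrite [RHS]exchange_big /=; apply: eq_bigr => y _; rewrite -/(G x y).
  have [->|Gxy] := eqVneq (G x y) 0%N; first by rewrite big1 // => z _; rewrite muln0.
  have /and3P[/eqP E xX yX] := GX x y Gxy.
  rewrite (@sum_nat_eq (fun=> G x y)) // ltnS gcdn_gt0.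
  have [x0|x0] := posnP x.
    have y0 : (0 < y)%N by rewrite lt0n; apply/eqP => y0; move: E; rewrite x0 y0 /qform; lia.
    by rewrite x0 gcd0n y0 yX.
  by rewrite /= (leq_trans (dvdn_leq x0 (dvdn_gcdl x y)) xX).
rewrite [RHS]big_mkcond big_nat_cond [RHS]big_nat_cond.
apply: eq_bigr => m /andP[/andP[m0 _] _].
transitivity (\sum_(0 <= x < X.+1) \sum_(0 <= y < X.+1)
    coprime x y * G (m * x) (m * y))%N.
  transitivity (\sum_(0 <= x < X.+1) \sum_(0 <= y < X.+1)
     (gcdn x (m * y) == m) * G x (m * y))%N.
    apply: eq_bigr => x _.
    apply: (@sum_multiples (fun y => (gcdn x y == m) * G x y)%N) => // y.
    rewrite muln_eq0 negb_or => /andP[+ /GX/and3P[_ _ ->]].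
    by rewrite eqb0 negbK => /eqP <-; rewrite dvdn_gcdr.
  rewrite exchange_big [RHS]exchange_big /=; apply: eq_bigr => y _.
  rewrite (@sum_multiples (fun x => (gcdn x (m * y) == m) * G x (m * y))%N m) //.
    apply: eq_bigr => x _; rewrite -muln_gcdr; congr (nat_of_bool _ * _)%N.
    by rewrite -{2}[m]muln1 eqn_pmul2l.
  move=> x; rewrite muln_eq0 negb_or => /andP[+ /GX/and3P[_ -> _]].
  by rewrite eqb0 negbK => /eqP <-; rewrite dvdn_gcdl.
have [mAB|mAB] := boolP (coprime m (A * B)); last first.
  apply: big1 => x _; apply: big1 => y _; rewrite /G /cop !coprimeMl.
  move: mAB; rewrite coprimeMr negb_and => /orP[] /negbTE ->; rewrite ?andbF ?muln0 //.
have := mAB; rewrite coprimeMr => /andP[mA mB].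
transitivity (\sum_(1 <= k < X.+1) \sum_(0 <= x < X.+1) \sum_(0 <= y < X.+1)
   (m ^ 2 * k == n) * (sign_weight x * sign_weight y *
      (prim A B x y && (qform e f x y == k))))%N; last first.
  rewrite big_nat_cond [RHS]big_nat_cond; apply: eq_bigr => k /andP[/andP[k0 kX] _].
  rewrite (reps_box _ e0 f0 (kX : (k <= X)%N)) big_distrr /=.
  by apply: eq_bigr => x _; rewrite big_distrr.
rewrite [RHS]exchange_big /=; apply: eq_bigr => x _.
rewrite [RHS]exchange_big /=; apply: eq_bigr => y _.
rewrite /G !sign_weightM // qformM /prim /cop !coprimeMl mA mB /=.
case: (coprime x y) => /=; last by rewrite mul0n big1 // => k _; rewrite !muln0.
case: (coprime x A && coprime y B) => /=; last by rewrite !muln0 big1 // => k _; rewrite !muln0.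
set q := qform e f x y; rewrite mul1n.
have [E|E] := eqVneq (m ^ 2 * q)%N n; last first.
  rewrite muln0 big1 // => k _; case: (eqVneq q k) => [<-|]; last by rewrite !muln0.
  by rewrite (negbTE E).
have qX : (1 <= q < X.+1)%N.
  have : (0 < m ^ 2 * q)%N by rewrite E.
  rewrite muln_gt0 => /andP[m20 q0]; rewrite q0 ltnS; apply: leq_trans nX.
  by rewrite -E leq_pmull.
transitivity (\sum_(1 <= k < X.+1) (q == k) *
   ((m ^ 2 * k == n) * (sign_weight x * sign_weight y)))%N.
  by rewrite sum_nat_eq // E eqxx mul1n muln1.
by apply: eq_bigr => k _; rewrite mulnCA; congr muln; rewrite mulnC.
Qed.

Lemma psum_truncate {R : realType} (f : nat -> R) k X : (0 < k)%N ->
  psum f (X %/ k) = \sum_(1 <= l < X.+1) (k * l <= X)%N%:R * f l.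
Proof.
move=> k0; rewrite /psum (@big_cat_nat _ _ _ (X %/ k).+1 1 X.+1) //=; last first.
  by rewrite ltnS leq_div.
rewrite [X in _ = _ + X]big_nat_cond [X in _ = _ + X]big1 ?addr0.
  apply: eq_big_nat => l /andP[_]; rewrite ltnS leq_divRL // mulnC => ->.
  by rewrite mul1r.
move=> l /andP[/andP[+ _] _]; rewrite ltnNge leq_divRL // mulnC => /negbTE ->.
by rewrite mul0r.
Qed.

Lemma sum_eq_indic (a X : nat) : (0 < a)%N ->
  (\sum_(1 <= n < X.+1) (a == n) = (a <= X))%N.
Proof.
move=> a0; have [aX|aX] := leqP a X.
  have := @sum_nat_eq (fun=> 1%N) a 1 X.+1; rewrite ltnS a0 aX => /(_ isT) E.
  by rewrite -[RHS]E; apply: eq_bigr => n _; rewrite muln1.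
rewrite big_nat_cond big1 // => n /andP[/andP[_ nX] _].
by apply/eqP; rewrite eqb0; apply/eqP => E; move: nX aX; rewrite E ltnS ltnNge => ->.
Qed.

Lemma psum_reps_prim {R : realType} e f A B X : (0 < e)%N -> (0 < f)%N ->
  psum (fun k => (reps e f (cop A B) k)%:R / k%:R) X =
  \sum_(1 <= m < X.+1 | coprime m (A * B)) (m%:R ^+ 2)^-1 *
     psum (fun k => (reps e f (prim A B) k)%:R / k%:R) (X %/ m ^ 2) :> R.
Proof.
move=> e0 f0.
transitivity (\sum_(1 <= n < X.+1) \sum_(1 <= m < X.+1 | coprime m (A * B))
   \sum_(1 <= k < X.+1) (m ^ 2 * k == n)%N%:R *
     ((m%:R ^+ 2)^-1 * ((reps e f (prim A B) k)%:R / k%:R)) : R).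
  apply: eq_big_nat => n /andP[n0 nX].
  rewrite (@reps_prim e f A B n X) // natr_sum big_distrl /=; apply: eq_bigr => m _.
  rewrite natr_sum big_distrl /=; apply: eq_bigr => k _; rewrite natrM.
  case: eqP => [<-|_]; last by rewrite !mul0r.
  by rewrite !mul1r natrM natrX invfM mulrCA.
rewrite exchange_big /= big_nat_cond [RHS]big_nat_cond.
apply: eq_bigr => m /andP[/andP[m0 _] _].
rewrite exchange_big /= psum_truncate ?expn_gt0 ?m0 // big_distrr /=.
rewrite big_nat_cond [RHS]big_nat_cond; apply: eq_bigr => k /andP[/andP[k0 _] _].
rewrite -big_distrl /= -natr_sum sum_eq_indic ?muln_gt0 ?expn_gt0 ?m0 //.
by rewrite mulrCA.
Qed.

Lemma psum_dconv {R : realType} (f g : nat -> nat) X :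
  psum (fun n => (dconv f g n)%:R) X =
  psum (fun k => (f k)%:R * psum (fun l => (g l)%:R) (X %/ k)) X :> R.
Proof.
have box n : (0 < n <= X)%N -> dconv f g n =
   (\sum_(1 <= k < X.+1) \sum_(1 <= l < X.+1) (k * l == n) * (f k * g l))%N.
  move=> /andP[n0 nX]; rewrite /dconv (@big_cat_nat _ _ _ n.+1 1 X.+1) //=.
  rewrite [X in _ = (_ + X)%N]big_nat_cond [X in _ = (_ + X)%N]big1 ?addn0.
    apply: eq_big_nat => k /andP[k0 _].
    rewrite (@big_cat_nat _ _ _ n.+1 1 X.+1) //=.
    rewrite [X in _ = (_ + X)%N]big_nat_cond [X in _ = (_ + X)%N]big1 ?addn0 //.
    move=> l /andP[/andP[nl _] _]; case: eqP => // E.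
    by move: nl; rewrite -E ltnNge leq_pmull.
  move=> k /andP[/andP[nk _] _]; rewrite big_nat_cond big1 // => l /andP[/andP[l0 _] _].
  by case: eqP => // E; move: nk; rewrite -E ltnNge leq_pmulr.
transitivity (\sum_(1 <= n < X.+1) \sum_(1 <= k < X.+1) \sum_(1 <= l < X.+1)
   (k * l == n)%N%:R * ((f k)%:R * (g l)%:R) : R).
  apply: eq_big_nat => n nX; rewrite box // natr_sum; apply: eq_bigr => k _.
  by rewrite natr_sum; apply: eq_bigr => l _; rewrite !natrM.
rewrite exchange_big /=; apply: eq_big_nat => k /andP[k0 _].
rewrite exchange_big /= psum_truncate // big_distrr /=.
apply: eq_big_nat => l /andP[l0 _].
by rewrite -big_distrl /= -natr_sum sum_eq_indic ?muln_gt0 ?k0 // mulrCA.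
Qed.

Lemma mean_value_bound {R : realType} (f : nat -> R) c : mean_value f c ->
  exists B, forall n, psum f n <= B * n%:R.
Proof.
move=> /(_ 1 ltr01)[C HC]; exists (c + 1 + `|C|); case=> [|n].
  by rewrite psum0 mulr0.
have := HC n.+1; rewrite ler_norml => /andP[_] H.
have : C <= `|C| * n.+1%:R.
  by apply: le_trans (ler_norm C) _; rewrite ler_peMr // ler1n.
have -> : (c + 1 + `|C|) * n.+1%:R = c * n.+1%:R + 1 * n.+1%:R + `|C| * n.+1%:R by ring.
by move: H; move: (n.+1%:R : R) => z; lra.
Qed.

(** zeta(2) without its Euler factors at the primes dividing D. *)
Definition zeta_prod {R : realType} (D : nat) : R :=
  pi ^+ 2 / 6 * \prod_(p <- primes D) (1 - (p%:R ^+ 2)^-1).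

(** The density of the integers prime to A. *)
Definition tratio {R : realType} (A : nat) : R := (totient A)%:R / A%:R.

Lemma dconv_mean {R : realType} e f A B A' B' : (0 < e)%N -> (0 < f)%N ->
  (0 < A)%N -> (0 < B)%N -> (0 < A')%N -> (0 < B')%N ->
  negl (fun n => psum (fun m =>
          (dconv (reps e f (prim A B)) (reps e f (cop A' B')) m)%:R) n -
         pi / Num.sqrt (e * f)%:R * tratio A * tratio B / zeta_prod (A * B) *
         (pi / Num.sqrt (e * f)%:R * tratio A' * tratio B') * (n%:R * harm n))
       (fun n => n%:R * harm n : R).
Proof.
move=> e0 f0 A0 B0 A0' B0'.
have Hcop := @reps_mean R e f A B e0 f0 A0 B0.
have [Bd HBd] := mean_value_bound Hcop.
have c0 : 0 <= pi / Num.sqrt (e * f)%:R * tratio A * tratio B :> R.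
  by rewrite !mulr_ge0 ?invr_ge0 ?sqrtr_ge0 // ltW // pi_gt0.
have AB0 : (0 < A * B)%N by rewrite muln_gt0 A0.
have Hlog : log_mean (fun k => (reps e f (prim A B) k)%:R : R)
    (pi / Num.sqrt (e * f)%:R * tratio A * tratio B / zeta_prod (A * B)).
  apply: (@log_mean_square_factor R (fun k => (reps e f (cop A B) k)%:R) _
    (fun m => coprime m (A * B))) => //.
  - by rewrite coprime1n.
  - by move=> n; exact: psum_reps_prim.
  - exact: zsum_coprime_cvg.
  - exact: mean_value_log_mean.
have := dirichlet_mean _ _ Hlog (@reps_mean R e f A' B' e0 f0 A0' B0').
move=> /(_ Bd) H; apply: negl_eq (H _ _) => [n||n].
- by rewrite psum_dconv.
- by [].
apply: le_trans (HBd n); apply: ler_psum => k _; rewrite ler_nat.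
apply: leq_sum => x _; apply: leq_sum => y _; rewrite leq_mul2l /prim.
by case: (coprime x y); rewrite ?leqnn ?orbT.
Qed.

(** As [harm (4 * n)] exceeds [harm n] by at most 3, the dilation multiplies the main term by 4 up
    to a linear error. *)
Lemma negl_dilate4 {R : realType} (F : nat -> R) c :
  negl (fun n => F n - c * (n%:R * harm n)) (fun n => n%:R * harm n) ->
  negl (fun n => F (4 * n)%N - 4 * c * (n%:R * harm n)) (fun n => n%:R * harm n).
Proof.
move=> H eps e0.
have e8 : 0 < eps / 8 by lra.
have [C1 HC1] := H _ e8.
have e2 : 0 < eps / 2 by lra.
have [C2 HC2] := negl_linear (3 * eps / 2 + 12 * `|c|) e2.
exists (C1 + C2) => n; set h : R := harm n; set h4 : R := harm (4 * n).
have h0 : 0 <= h by exact: harm_ge0.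
have hh : h <= h4 by apply: psum_mono; [move=> k; rewrite invr_ge0|rewrite leq_pmull].
have hh4 : h4 <= h + 3 by exact: (@harm_mul R 3 n).
have n0 : 0 <= n%:R :> R by [].
have X1 := HC1 (4 * n)%N; rewrite natrM -/h4 in X1.
have X2 := le_trans (ler_norm _) (HC2 n); rewrite -/h in X2.
have Y1 : n%:R * h4 <= n%:R * h + 3 * n%:R.
  by rewrite [3 * _]mulrC -mulrDr ler_wpM2l.
have Y2 : `|c * (4%:R * n%:R * h4) - 4 * c * (n%:R * h)| <= 12 * `|c| * n%:R.
  have -> : c * (4%:R * n%:R * h4) - 4 * c * (n%:R * h) = c * (4 * n%:R * (h4 - h)) by ring.
  have -> : 12 * `|c| * n%:R = `|c| * (4 * n%:R * 3) by ring.
  rewrite normrM ler_wpM2l // ger0_norm; last by rewrite !mulr_ge0 // subr_ge0.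
  by rewrite ler_wpM2l ?mulr_ge0 // lerBlDl.
have -> : F (4 * n)%N - 4 * c * (n%:R * h) = (F (4 * n)%N - c * (4%:R * n%:R * h4)) +
  (c * (4%:R * n%:R * h4) - 4 * c * (n%:R * h)) by ring.
apply: le_trans (ler_normD _ _) _; apply: le_trans (lerD X1 Y2) _.
have Z : eps / 8 * (4%:R * n%:R * h4) <= eps / 2 * (n%:R * h + 3 * n%:R).
  have -> : eps / 8 * (4%:R * n%:R * h4) = eps / 2 * (n%:R * h4) by field.
  by rewrite ler_wpM2l // ltW.
have W : (3 * eps / 2 + 12 * `|c|) * n%:R = eps / 2 * (3 * n%:R) + 12 * `|c| * n%:R by field.
rewrite W in X2; rewrite mulrDr in Z.
have -> : eps * (n%:R * h) = eps / 2 * (n%:R * h) + eps / 2 * (n%:R * h) by field.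
by lra.
Qed.

Lemma psum_multiples4 {R : realType} (F : nat -> R) n :
  (forall m, ~~ (4 %| m)%N -> F m = 0) ->
  psum (fun k => F (4 * k)%N) n = psum F (4 * n).
Proof.
move=> HF; elim: n => [|n IH]; first by rewrite muln0 !psum0.
have -> : (4 * n.+1 = (4 * n).+4)%N by lia.
rewrite !psumS IH.
rewrite (HF (4 * n).+1) ?(HF (4 * n).+2) ?(HF (4 * n).+3) ?addr0; [|lia..].
by congr (_ + F _); lia.
Qed.

Lemma reps_odd0 e f (P : nat -> nat -> bool) k : odd e -> odd f -> (forall x y, P x y -> odd x && odd y) ->
  odd k -> reps e f P k = 0%N.
Proof.
move=> oe of_ HP ok; rewrite /reps; apply: big1 => x _; apply: big1 => y _.
case: (boolP (P x y)) => [/HP/andP[ox oy]|]; last by rewrite muln0.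
case: eqP => [E|]; last by rewrite muln0.
by move: ok; rewrite -E /qform oddD !oddM ox oy oe of_.
Qed.

Lemma dconv_odd0 e f A B m : odd e -> odd f -> ~~ (4 %| m)%N ->
  dconv (reps e f (prim (2 * A) (2 * B))) (reps e f (cop 2 2)) m = 0%N.
Proof.
move=> oe of_ m4; rewrite /dconv big1 // => k _; rewrite big1 // => l _.
case: eqP => // E; rewrite mul1n.
have [ok|ek] := boolP (odd k).
  rewrite (@reps_odd0 e f _ k) // => x y; rewrite -prim_double => /andP[] //.
have [ol|el] := boolP (odd l).
  rewrite (@reps_odd0 e f (cop 2 2) l) ?muln0 // => x y.
  by rewrite /cop !coprimen2.
by move: m4; rewrite -E (_ : 4 = 2 * 2)%N // dvdn_mul // dvdn2.
Qed.

(** * Evaluation of the constant *)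

Lemma tratio_prod {R : realType} N : (0 < N)%N ->
  tratio N = \prod_(p <- primes N) (1 - p%:R^-1) :> R.
Proof.
move=> N0; rewrite /tratio totientE // natr_prod.
have -> : N%:R = \prod_(p <- primes N) (p ^ logn p N)%:R :> R.
  by rewrite {1}(prod_prime_decomp N0) prime_decompE big_map natr_prod.
rewrite -prodf_div; apply: eq_big_seq => p; rewrite mem_primes => /and3P[pp _ pN].
have : (0 < logn p N)%N by rewrite logn_gt0 mem_primes pp N0.
case: (logn p N) => // k _; rewrite /= natrM expnS natrM.
have p0 : p%:R != 0 :> R by rewrite pnatr_eq0 -lt0n prime_gt0.
have pk0 : (p ^ k)%:R != 0 :> R by rewrite pnatr_eq0 -lt0n expn_gt0 prime_gt0.
have -> : p%:R = p.-1%:R + 1 :> R by rewrite natr1 prednK // prime_gt0.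
have p1 : p.-1%:R + 1 != 0 :> R by rewrite natr1 prednK // prime_gt0.
by field; rewrite p1 pk0.
Qed.

Lemma zeta_factor_gt0 {R : realType} p : prime p -> 0 < 1 - (p%:R ^+ 2)^-1 :> R.
Proof.
move=> pp; rewrite subr_gt0 invf_lt1 ?exprn_gt0 ?ltr0n ?prime_gt0 //.
by rewrite exprn_egt1 // ltr1n prime_gt1.
Qed.

Lemma zeta_factors_gt0 {R : realType} N :
  0 < \prod_(p <- primes N) (1 - (p%:R ^+ 2)^-1) :> R.
Proof.
rewrite big_seq; apply: prodr_gt0 => p; rewrite mem_primes => /andP[pp _].
exact: zeta_factor_gt0.
Qed.

(** Prime by prime, (1 - 1/p) / (1 - 1/p^2) = 1 / (1 + 1/p); this is the origin of p / (p + 1) in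
    the final constant. *)
Lemma tratio_zeta {R : realType} N : (0 < N)%N ->
  tratio N / \prod_(p <- primes N) (1 - (p%:R ^+ 2)^-1) =
  \prod_(p <- primes N) (p%:R / (p%:R + 1)) :> R.
Proof.
move=> N0; rewrite tratio_prod // -prodf_div; apply: eq_big_seq => p.
rewrite mem_primes => /and3P[pp _ _].
have p1 : 1 < p%:R :> R by rewrite ltr1n prime_gt1.
have p0 : p%:R != 0 :> R by rewrite gt_eqF //; lra.
have pp1 : p%:R + 1 != 0 :> R by rewrite gt_eqF //; lra.
have pm1 : p%:R - 1 != 0 :> R by rewrite gt_eqF //; lra.
have -> : 1 - (p%:R ^+ 2)^-1 = (p%:R - 1) * (p%:R + 1) / p%:R ^+ 2 :> R by field.
by field; rewrite p0 pp1 pm1.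
Qed.

Lemma squarefree_coprime N e f : squarefree N -> (e * f)%N = N -> coprime e f.
Proof.
move=> sq efN; apply/eqP; apply: sq.
by rewrite -efN -mulnn dvdn_mul ?dvdn_gcdl ?dvdn_gcdr.
Qed.

Lemma tratioM {R : realType} e f : coprime e f ->
  tratio (e * f) = tratio e * tratio f :> R.
Proof.
move=> ef; rewrite /tratio totient_coprime // !natrM invfM; ring.
Qed.

Lemma tratio1 {R : realType} : tratio 1 = 1 :> R.
Proof. by rewrite /tratio totient_count_coprime big_nat1 divr1. Qed.

Lemma tratio2 {R : realType} : tratio 2 = 2^-1 :> R.
Proof. by rewrite /tratio (totient_prime (isT : prime 2)) mul1r. Qed.

(** The number of convolutions in the identity; it later supplies one factor 2 for each p / (p + 1)
    with p dividing N. *)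
Lemma size_divisors N : (0 < N)%N -> squarefree N -> size (divisors N) = (2 ^ size (primes N))%N.
Proof.
elim/ltn_ind: N => N IH N0 sq; have [N1|N1] := leqP N 1.
  by have -> : N = 1%N by lia.
move: (pdiv N) (pdiv_prime N1) (pdiv_dvd N) => p pp /dvdnP[m mE].
have m0 : (0 < m)%N by move: N0; rewrite mE muln_gt0 => /andP[].
have p1 := prime_gt1 pp.
have mN : (m < N)%N by rewrite mE ltn_Pmulr.
have pm : ~~ (p %| m)%N.
  apply/negP => /dvdnP[k kE]; have := sq p; rewrite mE kE -mulnA mulnn dvdn_mull // => /(_ isT).
  by move=> E; move: p1; rewrite E.
have sqm : squarefree m by move=> d dm; apply: sq; rewrite mE dvdn_mulr.
have dp : perm_eq (divisors N) (divisors m ++ [seq (d * p)%N | d <- divisors m]).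
  have injp : injective (fun d => d * p)%N.
    by move=> a b /eqP; rewrite eqn_pmul2r ?prime_gt0 // => /eqP.
  apply: uniq_perm; first exact: divisors_uniq.
    rewrite cat_uniq divisors_uniq map_inj_uniq // divisors_uniq andbT /=.
    apply/hasPn => _ /mapP[d _ ->]; rewrite -dvdn_divisors //.
    by apply: contra pm; apply: dvdn_trans; rewrite dvdn_mull.
  move=> d; rewrite mem_cat -!dvdn_divisors //.
  apply/idP/orP => [dN|[dm|/mapP[k]]].
  - have [/dvdnP[k kE]|pd] := boolP (p %| d)%N.
      right; apply/mapP; exists k; rewrite // -dvdn_divisors //.
      by move: dN; rewrite kE mE dvdn_pmul2r // prime_gt0.
    left; move: dN; rewrite mE Gauss_dvdl // coprime_sym prime_coprime //.
  - by rewrite mE dvdn_mulr.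
  - by rewrite -dvdn_divisors // => km ->; rewrite mE dvdn_pmul2r // prime_gt0.
have pp2 : perm_eq (primes N) (p :: primes m).
  apply: uniq_perm; first exact: primes_uniq.
    by rewrite /= primes_uniq mem_primes (negbTE pm) !andbF.
  by move=> q; rewrite mE (primesM _ m0 (prime_gt0 pp)) (primes_prime pp) !in_cons in_nil orbF orbC.
rewrite (perm_size dp) (perm_size pp2) size_cat size_map IH //= expnS; lia.
Qed.

Lemma prod_primes_double_odd {R : realType} N (F : nat -> R) : (0 < N)%N -> odd N ->
  \prod_(p <- primes (2 * N)) F p = F 2%N * \prod_(p <- primes N) F p.
Proof.
move=> N0 oN; have /(perm_big _) -> : perm_eq (primes (2 * N)) (2%N :: primes N).
  apply: uniq_perm; first exact: primes_uniq.
    by rewrite /= primes_uniq mem_primes dvdn2 oN !andbF.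
  by move=> q; rewrite primesM // (primes_prime (isT : prime 2)) in_cons in_cons in_nil orbF.
by rewrite big_cons.
Qed.

Lemma prod_primes_double_even {R : realType} N (F : nat -> R) : (0 < N)%N -> ~~ odd N ->
  \prod_(p <- primes (2 * N)) F p = \prod_(p <- primes N) F p.
Proof.
move=> N0 oN; apply: perm_big; apply: uniq_perm; try exact: primes_uniq.
move=> q; rewrite primesM // (primes_prime (isT : prime 2)) in_cons in_nil orbF.
by case: eqP => // ->; rewrite mem_primes N0 dvdn2 oN.
Qed.

Lemma prod_double {R : realType} (s : seq nat) (F : nat -> R) :
  \prod_(p <- s) (2 * F p) = (2 ^ size s)%:R * \prod_(p <- s) F p.
Proof.
elim: s => [|p s IH]; first by rewrite !big_nil mulr1.
by rewrite !big_cons IH /= expnS natrM; ring.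
Qed.

Lemma leading_const {R : realType} (s a b Q t : R) : 0 < s -> 0 < Q ->
  pi / s * a * b / (pi ^+ 2 / 6 * Q) * (pi / s * t * t) = 6 / (s * s) * (a * b) / Q * (t * t).
Proof.
move=> s0 Q0; have p0 := @pi_gt0 R; move: (@pi R) p0 => p p0.
by field; rewrite !gt_eqF.
Qed.

(** Since e and f are coprime, their densities multiply to that of N, and the value depends on N
    alone. *)
Lemma dconv_const {R : realType} N e f : (0 < N)%N -> squarefree N -> (e * f)%N = N ->
  pi / Num.sqrt (e * f)%:R * tratio f * tratio e / zeta_prod (f * e) *
    (pi / Num.sqrt (e * f)%:R * tratio 1 * tratio 1) =
  6 / N%:R * \prod_(p <- primes N) (p%:R / (p%:R + 1)) :> R.
Proof.
move=> N0 sq efN; have N0' : 0 < N%:R :> R by rewrite ltr0n.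
have cef := squarefree_coprime sq efN.
rewrite /zeta_prod [(f * e)%N]mulnC efN leading_const ?sqrtr_gt0 ?zeta_factors_gt0 //.
rewrite -expr2 sqr_sqrtr ?(ltW N0') // tratio1 !mulr1 -tratioM; last by rewrite coprime_sym.
by rewrite [(f * e)%N]mulnC efN -mulrA tratio_zeta.
Qed.

(** Relative to the other convolution, the prime 2 contributes 4 from the dilation, 1/2 for each of
    the four odd variables, and 1 / (1 - 1/4) from the zeta factor: 4 * 1/16 * 4/3 = 1/3. *)
Lemma dconv_const_odd {R : realType} N e f : (0 < N)%N -> squarefree N -> (e * f)%N = N ->
  odd N ->
  4 * (pi / Num.sqrt (e * f)%:R * tratio (2 * f) * tratio (2 * e) /
      zeta_prod (2 * f * (2 * e)) *
    (pi / Num.sqrt (e * f)%:R * tratio 2 * tratio 2)) =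
  6 / N%:R * \prod_(p <- primes N) (p%:R / (p%:R + 1)) / 3 :> R.
Proof.
move=> N0 sq efN oN; have N0' : 0 < N%:R :> R by rewrite ltr0n.
have cef := squarefree_coprime sq efN.
have := oN; rewrite -efN oddM => /andP[oe of_].
have -> : (2 * f * (2 * e) = 2 * (2 * N))%N by rewrite -efN; lia.
rewrite efN /zeta_prod leading_const ?sqrtr_gt0 ?zeta_factors_gt0 //.
rewrite prod_primes_double_even ?muln_gt0 ?oddM // prod_primes_double_odd //.
rewrite -expr2 sqr_sqrtr ?(ltW N0') // !tratioM ?coprime2n //.
rewrite tratio2 -tratio_zeta // -efN tratioM //.
have := @zeta_factors_gt0 R (e * f); set Q := \prod_(p <- _) _ => Q0.
have : (e * f)%:R != 0 :> R by rewrite efN gt_eqF.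
move: ((e * f)%:R : R) (gt_eqF Q0) => z /negbT Qn zn.
by field; rewrite zn Qn.
Qed.

(** * The asymptotic formula *)

(* In the second convolution only multiples of 4 contribute, because for odd
   e, f, x, y the value e x^2 + f y^2 is even. *)
Lemma sum_r2_sqr {R : realType} N n : (0 < N)%N -> squarefree N ->
  2 * psum (fun k => (r2 N k)%:R ^+ 2) n = \sum_(e <- divisors N)
    (psum (fun m => (dconv (reps e (N %/ e) (prim (N %/ e) e))
                           (reps e (N %/ e) (cop 1 1)) m)%:R) n +
     (odd N)%:R * psum (fun m => (dconv (reps e (N %/ e) (prim (2 * (N %/ e)) (2 * e)))
                           (reps e (N %/ e) (cop 2 2)) m)%:R) (4 * n)) :> R.
Proof.
move=> N0 sq.
have Nodd e f : (e * f)%N = N -> odd e || odd f.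
  by move=> efN; apply: coprime_odd; apply: squarefree_coprime efN.
rewrite -psumZ.
transitivity (psum (fun k => \sum_(e <- divisors N)
    ((dconv (reps e (N %/ e) (prim (N %/ e) e)) (reps e (N %/ e) (cop 1 1)) k)%:R +
     (odd N)%:R * (dconv (reps e (N %/ e) (prim (2 * (N %/ e)) (2 * e)))
                   (reps e (N %/ e) (cop 2 2)) (4 * k))%:R : R)) n).
  apply: eq_psum => k /andP[k0 _].
  rewrite -natrX -natrM r2_sqr_dconv // natr_sum; apply: eq_bigr => e _.
  by rewrite natrD natrM.
rewrite /psum exchange_big /= big_seq [RHS]big_seq; apply: eq_bigr => e.
rewrite mem_divisors_mul // => /eqP efN.
rewrite big_split /= -big_distrr /=; congr (_ + _).
have [oN|eN] := boolP (odd N); last by rewrite !mul0r.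
have := oN; rewrite -{1}efN oddM => /andP[oe of_].
rewrite !mul1r.
apply: (psum_multiples4 (F := fun m => (dconv (reps e (N %/ e) (prim (2 * (N %/ e)) (2 * e)))
                   (reps e (N %/ e) (cop 2 2)) m)%:R)) => m m4.
by rewrite dconv_odd0.
Qed.

Lemma sum_r2_sqr_negl {R : realType} N : (0 < N)%N -> squarefree N ->
  negl (fun n => psum (fun k => (r2 N k)%:R ^+ 2) n -
     3 / N%:R * (\prod_(p <- primes (2 * N)) (2 * p%:R / (p%:R + 1))) * (n%:R * harm n))
   (fun n => n%:R * harm n : R).
Proof.
move=> N0 sq.
pose kap : R := 6 / N%:R * \prod_(p <- primes N) (p%:R / (p%:R + 1)).
(* The factor 1/2 undoes the double cover. For odd N the sum 1 + 1/3 = 4/3 is the factor 2 p / (p +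
   1) at p = 2; for even N that prime already occurs among those of N. *)
have cE : 3 / N%:R * (\prod_(p <- primes (2 * N)) (2 * p%:R / (p%:R + 1))) =
    2^-1 * ((size (divisors N))%:R * (kap + (odd N)%:R * (kap / 3))).
  rewrite size_divisors // /kap.
  have dbl : \prod_(p <- primes N) (2 * p%:R / (p%:R + 1)) =
      (2 ^ size (primes N))%:R * \prod_(p <- primes N) (p%:R / (p%:R + 1)) :> R.
    by rewrite -prod_double; apply: eq_bigr => p _; rewrite mulrA.
  have [oN|eN] := boolP (odd N).
    rewrite prod_primes_double_odd // dbl mul1r.
    move: (\prod_(p <- _) _) ((2 ^ _)%:R) => P Z; field.
    by rewrite pnatr_eq0 -lt0n.
  rewrite prod_primes_double_even // dbl mul0r addr0.
  move: (\prod_(p <- _) _) ((2 ^ _)%:R) => P Z; field.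
  by rewrite pnatr_eq0 -lt0n.
pose W e n : R := psum (fun m => (dconv (reps e (N %/ e) (prim (N %/ e) e))
                           (reps e (N %/ e) (cop 1 1)) m)%:R) n +
     (odd N)%:R * psum (fun m => (dconv (reps e (N %/ e) (prim (2 * (N %/ e)) (2 * e)))
                           (reps e (N %/ e) (cop 2 2)) m)%:R) (4 * n).
have main : negl (fun n => \sum_(e <- divisors N)
    (W e n - (kap + (odd N)%:R * (kap / 3)) * (n%:R * harm n))) (fun n => n%:R * harm n : R).
  apply: negl_sum => [n|e]; first by rewrite mulr_ge0 ?harm_ge0.
  rewrite mem_divisors_mul // => /eqP efN.
  have e0 : (0 < e)%N by rewrite lt0n; apply/eqP => E; move: N0; rewrite -efN E.
  have f0 : (0 < N %/ e)%N by rewrite lt0n; apply/eqP => E; move: N0; rewrite -efN E muln0.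
  have H1 := @dconv_mean R e (N %/ e) (N %/ e) e 1 1 e0 f0 f0 e0 isT isT.
  rewrite (dconv_const N0 sq efN) -/kap in H1.
  have H2 : negl (fun n => (odd N)%:R * (psum (fun m => (dconv (reps e (N %/ e)
      (prim (2 * (N %/ e)) (2 * e))) (reps e (N %/ e) (cop 2 2)) m)%:R) (4 * n) -
      kap / 3 * (n%:R * harm n))) (fun n => n%:R * harm n : R).
    have [oN|eN] := boolP (odd N); last first.
      move=> eps eps0; exists 0 => n.
      by rewrite mul0r normr0 addr0 !mulr_ge0 ?harm_ge0 // ltW.
    apply: neglZ; rewrite -(dconv_const_odd N0 sq efN oN).
    by apply: negl_dilate4; apply: dconv_mean; rewrite // muln_gt0.
  by apply: negl_eq (neglD H1 H2) => n; rewrite /W; ring.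
apply: negl_eq (neglZ 2^-1 main) => n.
have cst (v : R) : \sum_(e <- divisors N) v = (size (divisors N))%:R * v.
  by rewrite big_const_seq count_predT iter_addr_0 mulr_natl.
rewrite cE sumrB -sum_r2_sqr // cst.
move: (kap + _) (psum _ n) (n%:R * harm n) ((size _)%:R) => a b c s.
by field.
Qed.

Lemma harm_ln_error {R : realType} (x : R) : 1 <= x ->
  `|(Num.truncn x)%:R * harm (Num.truncn x) - x * ln x| <= 2 * x.
Proof.
move=> x1; have x0 : 0 <= x by lra.
have xp : 0 < x by lra.
set n := Num.truncn x.
have nx : n%:R <= x by rewrite truncn_le.
have xn : x < n.+1%:R by exact: truncnS_gt.
have n0 : (0 < n)%N by rewrite truncn_gt0.
have lx0 : 0 <= ln x by exact: ln_ge0.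
have lxx : ln x <= x by rewrite ltW // ln_sublinear.
have L : ln x <= harm n.
  apply: le_trans (harm_ge_ln n); rewrite ler_ln ?posrE ?ltr0n //; exact: ltW.
have U : harm n <= 1 + ln x.
  case: (n) n0 nx => // m _ mx; apply: le_trans (harm_le_ln m) _.
  by rewrite lerD2l ler_ln ?posrE // ltr0n.
have nR : 0 <= n%:R :> R by [].
have n1 : x - 1 <= n%:R by move: xn; rewrite -natr1; lra.
have A1 : n%:R * harm n <= x * (1 + ln x).
  by apply: ler_pM => //; exact: harm_ge0.
have A2 : (x - 1) * ln x <= n%:R * harm n.
  by apply: ler_pM => //; lra.
move: A1 A2; rewrite mulrDr mulr1 mulrBl mul1r ler_norml; lra.
Qed.

Theorem theorem1p3 (R : realType) (N : nat) (N_gt0 : (0 < N)%N)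
  (N_sqf : squarefree N) (N_mod4 : (- N%:Z <> 1 %[mod 4])%Z) :
  (fun x : R =>
     (\sum_(1 <= n < (Num.truncn x).+1) (r2 N n)%:R ^+ 2) /
     (3 / N%:R * (\prod_(p <- primes (2 * N)) (2 * p%:R / (p%:R + 1))) *
        (x * ln x)) : R) @ +oo --> (1 : R).
Proof.
set K := 3 / N%:R * _.
have K0 : 0 < K.
  rewrite mulr_gt0 ?divr_gt0 ?ltr0n // big_seq; apply: prodr_gt0 => p.
  rewrite mem_primes => /andP[pp _]; have p0 : 0 < p%:R :> R by rewrite ltr0n prime_gt0.
  by rewrite divr_gt0 ?mulr_gt0 // addr_gt0.
apply/cvgrPdist_le => /= d d0.
have e0 : 0 < d * K / 3 by rewrite divr_gt0 // mulr_gt0.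
have [C HC] := sum_r2_sqr_negl N_gt0 N_sqf e0; rewrite -/K in HC.
(* M collects the coefficients of the errors linear in x: from replacing n [harm n] by x ln x + 2 x
   in the relative error, from the constant C, and from K times the distance between n [harm n] and
   x ln x. The relative error uses one third of d K x ln x, and ln x > A lets M x fit into the other
   two thirds. *)
pose M := 2 * (d * K / 3) + `|C| + 2 * K.
have M0 : 0 <= M by rewrite /M !addr_ge0 // mulr_ge0 // ltW.
pose A := M / (d * K * (2 / 3)).
exists (Num.max 1 (expR A)); split; first exact: num_real.
move=> x; rewrite gt_max => /andP[x1 xA].
have x0 : 0 < x by lra.
have lA : A < ln x by rewrite -[A]expRK ltr_ln ?posrE ?expR_gt0.
have dK0 : 0 < d * K * (2 / 3) by rewrite mulr_gt0 ?divr_gt0 // mulr_gt0.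
have A0 : 0 <= A by rewrite divr_ge0 // ltW.
have l0 : 0 < ln x by exact: le_lt_trans lA.
have MA : M * x <= d * K * (2 / 3) * (x * ln x).
  move: lA; rewrite ltr_pdivrMr // => lA.
  rewrite mulrA [_ * x * ln x]mulrAC ler_pM2r // ltW // mulrC //.
have E1 := HC (Num.truncn x); have E2 := harm_ln_error (ltW x1).
move: E1 E2; set nH := _ * harm _; rewrite -/(psum _ _); set S := psum _ _ => E1 E2.
have D0 : 0 < K * (x * ln x) by exact: mulr_gt0 K0 (mulr_gt0 x0 l0).
have nHle : nH <= x * ln x + 2 * x by move: E2; rewrite ler_norml => /andP[_]; lra.
have B : `|K * (x * ln x) - S| <= d * (K * (x * ln x)).
  have -> : K * (x * ln x) - S = - (S - K * nH) - K * (nH - x * ln x) by ring.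
  apply: le_trans (ler_normB _ _) _; rewrite normrN normrM (gtr0_norm K0).
  have B1 : d * K / 3 * nH <= d * K / 3 * (x * ln x + 2 * x) by rewrite ler_pM2l.
  have B2 : K * `|nH - x * ln x| <= K * (2 * x) by rewrite ler_pM2l.
  have B3 : C <= `|C| * x.
    by apply: le_trans (ler_norm C) _; rewrite ler_peMr // ltW.
  have -> : d * (K * (x * ln x)) = d * K / 3 * (x * ln x) + d * K * (2 / 3) * (x * ln x).
    by field.
  apply: le_trans (lerD (le_trans E1 (lerD B1 B3)) B2) _.
  rewrite mulrDr -!addrA lerD2l; apply: le_trans MA.
  by rewrite /M le_eqVlt; apply/orP; left; apply/eqP; ring.
have -> : 1 - S / (K * (x * ln x)) = (K * (x * ln x) - S) / (K * (x * ln x)).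
  by rewrite mulrBl divff // gt_eqF.
by rewrite normrM normfV (gtr0_norm D0) ler_pdivrMr.
Qed.
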